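(* Let $M$ be a connected simple binary matroid. Then $M$ has neither $M(K_4\backslash e)$ nor $M(K_4)$ as an induced minor if and only if $M$ is a binary projective geometry, a binary affine geometry of rank at least three, or a circuit with at least three elements.
   Context: All matroids are simple; every contraction is immediately followed by simplification. An induced restriction of a matroid $M$ is a restriction of $M$ to a flat. An induced minor of $M$ is a matroid obtained from $M$ by a sequence of restrictions to flats and contractions (each contraction followed by simplification); equivalently, by at most one restriction to a flat and at most one contraction followed by simplification, in either order. $K_4\backslash e$ denotes $K_4$ with one edge deleted. Projective and affine geometries here are over $GF(2)$. *)

(* Defs.v *)
From mathcomp Require Import all_boot all_algebra.

Set Implicit Arguments.
Unset Strict Implicit.
Unset Printing Implicit Defensive.

Import GRing.Theory.

(* The ground set is a subset of a finite type, so that a minor of a matroid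
   on T is again a matroid on T. *)
Record matroid (T : finType) := Matroid {
  ground : {set T};
  indep : {set {set T}};
  indep_ground : forall I : {set T}, I \in indep -> I \subset ground;
  indep0 : set0 \in indep;
  indepS : forall I J : {set T}, J \in indep -> I \subset J -> I \in indep;
  indep_aug : forall I J : {set T}, I \in indep -> J \in indep -> #|I| < #|J| ->
    exists2 e, e \in J :\: I & e |: I \in indep
}.

Section MatroidTheory.
Variables (T : finType) (M : matroid T).
Implicit Types (I J X B C S : {set T}) (e f : T).

Definition rank X := \max_(I in indep M | I \subset X) #|I|.

Definition matroid_rank := rank (ground M).

Definition mclosure X := [set e in ground M | rank (e |: X) == rank X].

Definition flat X := mclosure X == X.

Definition hyperplane X := flat X && ((rank X).+1 == matroid_rank).

Definition basis_of X B := maxset (fun I => (I \in indep M) && (I \subset X)) B.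

Definition dependent X := (X \subset ground M) && (X \notin indep M).

Definition circuit C := minset dependent C.

Definition loop e := circuit [set e].

Definition parallel e f := (e != f) && circuit [set e; f].

Definition simple_matroid :=
  (forall e, ~~ loop e) /\ (forall e f, ~~ parallel e f).

Definition connected_matroid :=
  forall e f, e \in ground M -> f \in ground M -> e != f ->
  exists C, [/\ circuit C, e \in C & f \in C].

(* S consists of exactly one element of each parallel class of M, where a
   parallel class is the set of all f equal or parallel to a given non-loop e. *)
Definition simplification_set S :=
  (forall f, f \in S -> (f \in ground M) && ~~ loop f) /\
  (forall e, e \in ground M -> ~~ loop e ->
     exists! f, f \in S /\ ((e == f) || parallel e f)).

End MatroidTheory.

Section Restriction.
Variables (T : finType) (M : matroid T) (X : {set T}).
Implicit Types (I J : {set T}).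

Definition restr_indep := [set I in indep M | I \subset X].

Fact restr_ground I : I \in restr_indep -> I \subset ground M :&: X.
Proof. by rewrite inE subsetI => /andP[/indep_ground-> ->]. Qed.

Fact restr0 : set0 \in restr_indep.
Proof. by rewrite inE indep0 sub0set. Qed.

Fact restrS I J : J \in restr_indep -> I \subset J -> I \in restr_indep.
Proof.
rewrite !inE => /andP[iJ sJX] sIJ.
by rewrite (indepS iJ sIJ) (subset_trans sIJ sJX).
Qed.

Fact restr_aug I J : I \in restr_indep -> J \in restr_indep -> #|I| < #|J| ->
  exists2 e, e \in J :\: I & e |: I \in restr_indep.
Proof.
rewrite !inE => /andP[iI sIX] /andP[iJ sJX] ltIJ.
have [e eJI ieI] := indep_aug iI iJ ltIJ; exists e => //.
rewrite inE ieI subUset sIX andbT sub1set (subsetP sJX) //.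
by move: eJI; rewrite inE => /andP[].
Qed.

Definition restrict := Matroid restr_ground restr0 restrS restr_aug.

End Restriction.

Section BasisLemmas.
Variables (T : finType) (M : matroid T).
Implicit Types (I J X B : {set T}).

Lemma basis_ofP X B : reflect
  [/\ B \in indep M, B \subset X &
      forall e, e \in X -> e |: B \in indep M -> e \in B]
  (basis_of M X B).
Proof.
apply: (iffP maxsetP) => [[/andP[iB sBX] maxB]|[iB sBX maxB]]; split=> //.
- move=> e eX ieB; rewrite -(maxB (e |: B)) ?setU11 ?subsetUr //.
  by rewrite ieB subUset sub1set eX.
- by rewrite iB.
move=> I /andP[iI sIX] sBI; apply/eqP; rewrite eqEsubset sBI andbT.
apply/subsetP=> e eI; apply: maxB; first exact: (subsetP sIX).
by apply: indepS iI _; rewrite subUset sub1set eI.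
Qed.

Lemma basis_of_exists X : exists B, basis_of M X B.
Proof.
have [|B maxB _] :=
  @maxset_exists T (fun I => (I \in indep M) && (I \subset X)) set0.
  by rewrite indep0 sub0set.
by exists B.
Qed.

Lemma indep_extend I J : I \in indep M -> J \in indep M -> #|I| <= #|J| ->
  exists K, [/\ K \in indep M, I \subset K, K \subset I :|: J & #|K| = #|J|].
Proof.
move=> iI iJ; have [n] := ubnP (#|J| - #|I|).
elim: n I iI => // n IHn I iI ltn leIJ.
have [eqIJ|neIJ] := eqVneq #|I| #|J|.
  by exists I; rewrite subsetUl subxx.
have ltIJ : #|I| < #|J| by rewrite ltn_neqAle neIJ.
have [e] := indep_aug iI iJ ltIJ; rewrite inE => /andP[eNI eJ] ieI.
have cardE : #|e |: I| = #|I|.+1 by rewrite cardsU1 eNI.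
have [||K [iK sK1 sK2 cK]] := IHn _ ieI.
- by rewrite cardE subnS prednK ?subn_gt0.
- by rewrite cardE.
exists K; split=> //; first exact: subset_trans (subsetUr _ _) sK1.
apply: subset_trans sK2 _; rewrite !subUset sub1set inE eJ orbT /=.
by rewrite subsetUl subsetUr.
Qed.

Lemma basis_of_card_le X B I :
  basis_of M X B -> I \in indep M -> I \subset X -> #|I| <= #|B|.
Proof.
move=> /basis_ofP[iB _ maxB] iI sIX; rewrite leqNgt; apply/negP=> ltBI.
have [e] := indep_aug iB iI ltBI; rewrite inE => /andP[/negP eNB eI] ieB.
by apply: eNB; apply: maxB ieB; apply: (subsetP sIX).
Qed.

Lemma basis_of_swap X B1 B2 I : basis_of M X B1 -> basis_of M X B2 ->
  [disjoint I & X] -> I :|: B1 \in indep M -> I :|: B2 \in indep M.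
Proof.
move=> bB1 bB2 dIX iIB1.
have [iB1 sB1X _] := basis_ofP _ _ bB1; have [iB2 sB2X maxB2] := basis_ofP _ _ bB2.
have eqB : #|B1| = #|B2|.
  by apply/eqP; rewrite eqn_leq !(basis_of_card_le (X := X)).
have disj (B : {set T}) : B \subset X -> #|I :|: B| = #|I| + #|B|.
  move=> sBX; rewrite cardsU disjoint_setI0 ?cards0 ?subn0 //.
  exact: disjointWr sBX dIX.
have [|K [iK sB2K sKU cK]] := indep_extend iB2 iIB1.
  by rewrite disj // eqB leq_addl.
have sKI : K \subset I :|: B2.
  apply/subsetP=> e eK; have := subsetP sKU _ eK.
  rewrite !inE => /or3P[-> | -> | eB1]; rewrite ?orbT //.
  rewrite maxB2 ?orbT //; first exact: (subsetP sB1X).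
  by apply: indepS iK _; rewrite subUset sub1set eK.
suff <- : K = I :|: B2 by [].
by apply/eqP; rewrite eqEcard sKI cK !disj // eqB leqnn.
Qed.

End BasisLemmas.

Section Contraction.
Variables (T : finType) (M : matroid T) (X : {set T}).
Implicit Types (I J : {set T}).

Definition contr_indep :=
  [set I : {set T} | (I \subset ground M :\: X) &&
     [exists B : {set T}, basis_of M X B && (I :|: B \in indep M)]].

Fact contr_ground I : I \in contr_indep -> I \subset ground M :\: X.
Proof. by rewrite inE => /andP[]. Qed.

Fact contr0 : set0 \in contr_indep.
Proof.
have [B bB] := basis_of_exists M X; rewrite inE sub0set /=.
by apply/existsP; exists B; rewrite bB set0U; case/basis_ofP: bB.
Qed.

Fact contrS I J : J \in contr_indep -> I \subset J -> I \in contr_indep.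
Proof.
rewrite !inE => /andP[sJ /existsP[B /andP[bB iJB]]] sIJ.
rewrite (subset_trans sIJ sJ); apply/existsP; exists B.
by rewrite bB (indepS iJB) ?setSU.
Qed.

Fact contr_aug I J : I \in contr_indep -> J \in contr_indep -> #|I| < #|J| ->
  exists2 e, e \in J :\: I & e |: I \in contr_indep.
Proof.
rewrite !inE => /andP[sI /existsP[B /andP[bB iIB]]].
move=> /andP[sJ /existsP[B' /andP[bB' iJB']]] ltIJ.
have [_ sBX _] := basis_ofP _ _ _ bB.
have dX (K : {set T}) : K \subset ground M :\: X -> [disjoint K & X].
  by rewrite subsetD => /andP[].
have iJB := basis_of_swap bB' bB (dX _ sJ) iJB'.
have cU (K : {set T}) : K \subset ground M :\: X -> #|K :|: B| = #|K| + #|B|.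
  move=> /dX dK; rewrite cardsU disjoint_setI0 ?cards0 ?subn0 //.
  exact: disjointWr sBX dK.
have [|e] := indep_aug iIB iJB; first by rewrite !cU ?ltn_add2r.
rewrite !inE negb_or => /andP[/andP[eNI eNB]]; rewrite (negPf eNB) orbF => eJ ieIB.
exists e; first by rewrite inE eNI.
rewrite inE subUset sub1set (subsetP sJ) // sI; apply/existsP; exists B.
by rewrite bB -setUA.
Qed.

Definition contract := Matroid contr_ground contr0 contrS contr_aug.

End Contraction.

(* The map f is only relevant on the ground set of M.  It can be total because
   the matroids used as second argument below all live on inhabited types. *)
Definition isomorphic (T T' : finType) (M : matroid T) (M' : matroid T') :=
  exists f : T -> T',
  [/\ {in ground M &, injective f}, f @: ground M = ground M' &
      forall I : {set T}, I \subset ground M ->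
        (f @: I \in indep M') = (I \in indep M)].

Inductive induced_minor (T : finType) (M : matroid T) : matroid T -> Prop :=
| induced_minor_refl : induced_minor M M
| induced_minor_restrict (N : matroid T) (F : {set T}) :
    induced_minor M N -> flat N F -> induced_minor M (restrict N F)
| induced_minor_contract (N : matroid T) (X S : {set T}) :
    induced_minor M N -> X \subset ground N ->
    simplification_set (contract N X) S ->
    induced_minor M (restrict (contract N X) S).

Definition has_induced_minor (T T' : finType) (M : matroid T) (N : matroid T') :=
  exists2 M' : matroid T, induced_minor M M' & isomorphic M' N.

Section VectorMatroid.
Variables (F : fieldType) (V : vectType F) (T : finType).
Variables (E : {set T}) (v : T -> V).
Implicit Types (I J : {set T}).

Definition vec_indep :=
  [set I : {set T} | (I \subset E) && free [seq v e | e <- enum I]].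

Fact vec_ground I : I \in vec_indep -> I \subset E.
Proof. by rewrite inE => /andP[]. Qed.

Fact vec0 : set0 \in vec_indep.
Proof. by rewrite inE sub0set enum_set0 nil_free. Qed.

Lemma enum_setU1 (e : T) (I : {set T}) :
  e \notin I -> perm_eq (enum (e |: I)) (e :: enum I).
Proof.
move=> eNI; apply: uniq_perm; rewrite ?enum_uniq //=.
  by rewrite mem_enum eNI enum_uniq.
by move=> x; rewrite inE !mem_enum !inE.
Qed.

Fact vecS I J : J \in vec_indep -> I \subset J -> I \in vec_indep.
Proof.
rewrite !inE => /andP[sJE fJ] sIJ; rewrite (subset_trans sIJ sJE) /=.
have pJ : perm_eq (enum J) (enum I ++ enum (J :\: I)).
  apply: uniq_perm; rewrite ?enum_uniq ?cat_uniq ?enum_uniq ?andbT //=.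
    by apply/hasPn=> x; rewrite !mem_enum inE => /andP[].
  move=> x; rewrite mem_cat !mem_enum inE.
  by case: (boolP (x \in I)) => //= /(subsetP sIJ).
move: fJ; rewrite (perm_free (perm_map v pJ)) map_cat.
exact: catl_free.
Qed.

Lemma vec_augE I J : free [seq v e | e <- enum J] -> #|I| < #|J| ->
  exists2 e, e \in J & v e \notin <<[seq v e | e <- enum I]>>%VS.
Proof.
move=> fJ ltIJ; apply/exists_inP; apply: contraLR ltIJ => /exists_inPn noe.
have sJI : (<<[seq v e | e <- enum J]>> <= <<[seq v e | e <- enum I]>>)%VS.
  apply/span_subvP=> _ /mapP[e eJ ->]; rewrite mem_enum in eJ.
  by have := noe _ eJ; rewrite negbK.
have := leq_trans (dimvS sJI) (dim_span _).
by rewrite (eqP fJ) !size_map -!cardE -leqNgt.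
Qed.

Fact vec_aug I J : I \in vec_indep -> J \in vec_indep -> #|I| < #|J| ->
  exists2 e, e \in J :\: I & e |: I \in vec_indep.
Proof.
rewrite !inE => /andP[sIE fI] /andP[sJE fJ] /(vec_augE fJ)[e eJ veN].
have eNI : e \notin I.
  apply: contra veN => eI; apply: memv_span; apply: map_f.
  by rewrite mem_enum.
exists e; first by rewrite inE eNI.
rewrite inE subUset sub1set (subsetP sJE) // sIE /=.
by rewrite (perm_free (perm_map v (enum_setU1 eNI))) /= free_cons veN.
Qed.

Definition vector_matroid := Matroid vec_ground vec0 vecS vec_aug.

End VectorMatroid.

Definition representable (F : fieldType) (T : finType) (M : matroid T) :=
  exists (m : nat) (v : T -> 'rV[F]_m),
    indep M = indep (vector_matroid (ground M) v).

Definition binary (T : finType) (M : matroid T) := representable 'F_2 M.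

(* PG(r-1, 2): over GF(2), each point of the projective space (a line of
   GF(2)^r) contains exactly one nonzero vector.  PG 0 is the empty matroid. *)
Definition PG (r : nat) : matroid 'rV['F_2]_r :=
  vector_matroid [set x : 'rV['F_2]_r | x != 0%R] id.

Definition projective_geometry (T : finType) (M : matroid T) :=
  exists r, isomorphic M (PG r).

Definition affine_geometry (T : finType) (M : matroid T) :=
  exists (r : nat) (H : {set 'rV['F_2]_r}),
    hyperplane (PG r) H /\ isomorphic M (restrict (PG r) (~: H)).

Record sgraph (V : finType) := SGraph {
  edges : {set {set V}};
  card_edge : forall A, A \in edges -> #|A| = 2
}.

Section CycleMatroid.
Variables (V : finType).
Implicit Types (F : {set {set V}}) (x y : V).

Definition adj F : rel V := [rel x y | [set x; y] \in F].

Definition acyclic F :=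
  [forall n : 'I_#|V|.+1, forall c : n.-tuple V, ucycleb (adj F) c ==> (n < 3)].

Lemma acyclicP F :
  reflect (forall c, ucycle (adj F) c -> size c < 3) (acyclic F).
Proof.
apply: (iffP forallP) => [acF c uc|acF n].
  have szc : size c < #|V|.+1.
    by rewrite ltnS; case/andP: uc => _ /card_uniqP <-; apply: max_card.
  have /forallP/(_ (in_tuple c))/implyP := acF (Ordinal szc).
  by apply.
by apply/forallP=> c; apply/implyP=> /acF; rewrite size_tuple.
Qed.

Lemma adj_sym F : symmetric (adj F).
Proof. by move=> x y; rewrite /adj /= setUC. Qed.

Lemma connect_adj_sym F : connect_sym (adj F).
Proof. exact/sym_connect_sym/adj_sym. Qed.

Lemma acyclicS F F' : acyclic F' -> F \subset F' -> acyclic F.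
Proof.
move=> /acyclicP acF' sFF'; apply/acyclicP=> c /andP[cF uc]; apply: acF'.
rewrite /ucycle /ucycleb uc andbT; apply: sub_cycle cF => x y /=.
exact: (subsetP sFF').
Qed.

Lemma set2_eqP (a b x y : V) : [set a; b] = [set x; y] ->
  (a = x /\ b = y) \/ (a = y /\ b = x).
Proof.
move=> eqS.
have E z : (z == a) || (z == b) = (z == x) || (z == y).
  by have /setP/(_ z) := eqS; rewrite !inE.
have := E a; rewrite eqxx /= => /esym/orP[]/eqP ea; [left|right]; split=> //.
- have := E b; rewrite eqxx orbT -ea => /esym/orP[]/eqP // eba.
  by have := E y; rewrite eqxx orbT eba orbb => /eqP.
- have := E b; rewrite eqxx orbT -ea => /esym/orP[]/eqP // eba.
  by have := E x; rewrite eqxx eba orbb => /eqP.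
Qed.

Lemma acyclic_add F x y :
  acyclic F -> ~~ connect (adj F) x y -> acyclic ([set x; y] |: F).
Proof.
move=> /acyclicP acF nxy.
apply/acyclicP=> c /andP[cF uc]; rewrite ltnNge; apply/negP=> szc.
have [cF0|/negP ncF] := boolP (cycle (adj F) c).
  by have := acF c; rewrite /ucycle /ucycleb cF0 uc ltnNge szc => /(_ isT).
have [z zc /negP nz] : exists2 z, z \in c & ~~ adj F z (next c z).
  apply/hasP; apply/negPn/negP => /hasPn all_z; apply: ncF.
  apply: cycle_from_next => // z zc; exact: negbNE (all_z z zc).
have [i p def_c] := rot_to zc.
have ncz : next c z = next (rot i c) z by rewrite next_rot.
move: cF uc szc nz; rewrite ncz -(rot_cycle i) -(rot_uniq i) -(size_rot i) def_c.
case: p {def_c ncz} => [|w [|u p]] //=.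
rewrite eqxx => /and3P[zw wu up] uq _ nz.
have {zw} eq_zw : [set z; w] = [set x; y].
  by case/setU1P: zw => [|/nz].
have wuF : adj F w u.
  case/setU1P: wu => // /[!(esym eq_zw)] /set2_eqP[[ewz _]|[_ euz]].
    by move: uq; rewrite ewz !inE eqxx.
  by move: uq; rewrite euz !inE eqxx orbT.
have upF : path (adj F) u (rcons p z).
  apply: (sub_in_path (P := predC1 w)) up => [a b /= aw bw|].
    case/setU1P=> //; rewrite -eq_zw.
    by move: aw bw; rewrite !inE => aw bw /set2_eqP[[_ /eqP]|[/eqP]];
      rewrite ?(negPf aw) ?(negPf bw).
  move: uq; rewrite /= all_rcons !inE !negb_or.
  case/and4P=> [/and3P[zw _ _] /andP[wNu wNp] _ _].
  rewrite /= zw eq_sym wNu; apply/allP=> a ap /=.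
  by apply: contraNneq wNp => <-.
have wz : connect (adj F) w z.
  apply/connectP; exists (u :: rcons p z); first by rewrite /= wuF.
  by rewrite /= last_rcons.
case/negP: nxy; case: (set2_eqP eq_zw) => [] [<- <-] //.
by rewrite connect_adj_sym.
Qed.

Lemma acyclic_bridge F x y : acyclic F -> [set x; y] \in F -> x != y ->
  ~~ connect (adj (F :\ [set x; y])) x y.
Proof.
move=> /acyclicP acF xyF nxy; apply/negP=> /connectP[p].
case/shortenP=> {}p pxp up _ def_y.
have pF : path (adj F) x p.
  by apply: sub_path pxp => a b /setD1P[].
have := acF (x :: p); rewrite /ucycle /ucycleb up andbT /= rcons_path pF -def_y.
rewrite andTb adj_sym [adj F x y]xyF => /(_ isT).
case: p pxp {up pF} def_y => [|w [|? ?]] //= pxp def_y _.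
  by rewrite def_y eqxx in nxy.
by case/andP: pxp => /setD1P[/eqP[]]; rewrite def_y.
Qed.

(* Forests satisfy the augmentation axiom because they are linearly independent
   in the incidence space over GF(2). *)
Local Notation W := {ffun V -> ('F_2)^o}.

Definition incidence (A : {set V}) : W := [ffun z => ((z \in A)%:R : 'F_2)%R].

Local Notation incseq F := [seq incidence A | A <- enum F].

Lemma incidence2 x y : x != y ->
  incidence [set x; y] = (incidence [set x] + incidence [set y])%R.
Proof.
move=> nxy; apply/ffunP=> z; rewrite !ffunE !inE.
have [->|] := eqVneq z x; first by rewrite (negPf nxy) addr0.
by rewrite add0r.
Qed.

Lemma connect_incidence F x y :
  (forall A, A \in F -> #|A| = 2) -> connect (adj F) x y ->
  (incidence [set x] + incidence [set y])%R \in <<incseq F>>%VS.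
Proof.
move=> F2 /connectP[p]; elim: p x => [|z p IHp] x /=.
  move=> _ ->; rewrite (_ : _ + _ = 0)%R ?mem0v //.
  by apply/ffunP=> z; rewrite !ffunE addrr_pchar2 ?pchar_Fp.
move=> /andP[xzF pzp] def_y.
have nxz : x != z by have := F2 _ xzF; rewrite cards2; case: (x != z).
have := memvD (memv_span (map_f incidence _)) (IHp z pzp def_y).
move=> /(_ [set x; z]); rewrite mem_enum => /(_ xzF).
rewrite incidence2 // addrA -(addrA (incidence [set x])).
rewrite (_ : incidence [set z] + _ = 0)%R ?addr0 //.
by apply/ffunP=> t; rewrite !ffunE addrr_pchar2 ?pchar_Fp.
Qed.

Lemma sum_incidence_span (C : {set V}) (s : seq W) (w : W) :
  (forall u, u \in s -> (\sum_(z in C) u z = 0)%R) ->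
  w \in <<s>>%VS -> (\sum_(z in C) w z = 0)%R.
Proof.
move=> s0 /(@coord_span _ _ _ (in_tuple s)) ->.
under eq_bigr do rewrite sum_ffunE.
rewrite exchange_big big1 //= => i _.
under eq_bigr do rewrite ffunE.
by rewrite -scaler_sumr s0 ?scaler0 // mem_nth.
Qed.

Lemma acyclic_free F :
  (forall A, A \in F -> #|A| = 2) -> acyclic F -> free (incseq F).
Proof.
have [n] := ubnP #|F|; elim: n F => // n IHn F ltFn F2 acF.
have [->|[A AF]] := set_0Vmem F; first by rewrite enum_set0 nil_free.
have /eqP/cards2P[x [y [nxy defA]]] := F2 _ AF; rewrite {A}defA in AF.
have fF' : free (incseq (F :\ [set x; y])).
  apply: IHn.
  - by move: ltFn; rewrite (cardsD1 [set x; y]) AF.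
  - by move=> A; rewrite inE => /andP[_]; apply: F2.
  by apply: acyclicS acF _; apply: subsetDl.
have nconn := acyclic_bridge acF AF nxy.
rewrite -(setD1K AF) (perm_free (perm_map _ (enum_setU1 _))) ?setD11 //=.
rewrite free_cons fF' andbT; apply/negP.
pose C := [set z | connect (adj (F :\ [set x; y])) x z].
have sum1 a : (\sum_(z in C) incidence [set a] z = (a \in C)%:R)%R.
  under eq_bigr do rewrite ffunE in_set1.
  rewrite -natr_sum; congr (_%:R)%R; have [aC|aC] := boolP (a \in C).
    by rewrite (bigD1 a) //= eqxx big1 // => z /andP[_ /negPf->].
  by rewrite big1 // => z zC; case: eqP aC => // <-; rewrite zC.
have sum2 a b : a != b ->
    (\sum_(z in C) incidence [set a; b] z = ((a \in C) + (b \in C))%:R)%R.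
  move=> nab; rewrite (incidence2 nab).
  under eq_bigr do rewrite ffunE.
  by rewrite big_split natrD /= !sum1.
move=> /(@sum_incidence_span C) H.
have : (\sum_(z in C) incidence [set x; y] z = 0 :> 'F_2)%R.
  apply: H => _ /mapP[A + ->]; rewrite mem_enum => AF'.
  have /eqP/cards2P[a [b [nab defA]]] : #|A| = 2.
    by apply: F2; move: AF'; rewrite inE => /andP[].
  rewrite {A}defA in AF' *; rewrite (sum2 _ _ nab).
  have -> : (a \in C) = (b \in C).
    rewrite !inE; apply: same_connect_r; first exact: connect_adj_sym.
    exact: connect1.
  by rewrite natrD addrr_pchar2 ?pchar_Fp.
rewrite (sum2 _ _ nxy) !inE connect0 (negPf nconn) addn0.
by move/eqP; rewrite oner_eq0.
Qed.

Variable G : sgraph V.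

Definition forests := [set F : {set {set V}} | (F \subset edges G) && acyclic F].

Implicit Types (I J : {set {set V}}).

Fact forest_ground F : F \in forests -> F \subset edges G.
Proof. by rewrite inE => /andP[]. Qed.

Fact forest0 : set0 \in forests.
Proof.
rewrite inE sub0set; apply/acyclicP=> c /andP[].
by case: c => // x c; case: c => [|y c] /andP[]; rewrite /adj /= in_set0.
Qed.

Fact forestS I J : J \in forests -> I \subset J -> I \in forests.
Proof.
rewrite !inE => /andP[sJE aJ] sIJ.
by rewrite (subset_trans sIJ sJE) (acyclicS aJ sIJ).
Qed.

Fact forest_aug I J : I \in forests -> J \in forests -> #|I| < #|J| ->
  exists2 e, e \in J :\: I & e |: I \in forests.
Proof.
rewrite !inE => /andP[sI aI] /andP[sJ aJ].
have c2 (F : {set {set V}}) : F \subset edges G -> forall A, A \in F -> #|A| = 2.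
  by move=> /subsetP sF A /sF; apply: card_edge.
move=> /(vec_augE (acyclic_free (c2 _ sJ) aJ))[A AJ AN].
have ANI : A \notin I.
  apply: contra AN => AI; apply: memv_span; apply: map_f.
  by rewrite mem_enum.
exists A; first by rewrite inE ANI.
rewrite inE subUset sub1set (subsetP sJ) // sI /=.
have /eqP/cards2P[x [y [nxy defA]]] := c2 _ sJ _ AJ; subst A.
apply: acyclic_add => //; apply: contra AN => xy.
by rewrite incidence2 // connect_incidence //; apply: c2.
Qed.

Definition cycle_matroid : matroid {set V} :=
  Matroid forest_ground forest0 forestS forest_aug.

End CycleMatroid.

Fact complete_card_edge (V : finType) (A : {set V}) :
  A \in [set B : {set V} | #|B| == 2] -> #|A| = 2.
Proof. by rewrite inE => /eqP. Qed.

Definition complete_graph (n : nat) : sgraph 'I_n :=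
  SGraph (@complete_card_edge 'I_n).

Fact del_card_edge (V : finType) (G : sgraph V) (e A : {set V}) :
  A \in edges G :\ e -> #|A| = 2.
Proof. by rewrite inE => /andP[_ /card_edge]. Qed.

Definition delete_edge (V : finType) (G : sgraph V) (e : {set V}) : sgraph V :=
  SGraph (@del_card_edge V G e).

Definition K4 : sgraph 'I_4 := complete_graph 4.

Definition K4_minus_edge : sgraph 'I_4 :=
  delete_edge K4 [set ord0; ord_max].

(* Main.v *)
(* Fix vectors v e over GF(2) representing M and read them modulo the span of a
   contracted set X.  Excluding K4\e and K4 means that, in every such
   contraction, two lines with a common point span a plane all of whose seven
   points are present; hence "equal or collinear" is an equivalence relation on
   the points of M/X, and its classes are projective geometries.  A class
   containing a line is a union of components of M/X: in a minimal relation that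
   violates this, contracting all but a few elements exposes a bad plane.

   Let C be a shortest circuit of M and contract all but three of its elements,
   so that C becomes a line.  If |C| = 3, connectivity makes the class of this
   line all of M, a projective geometry.  If |C| = 4 and d is the contracted
   element, the class is everything but d, so M contains the sum of d with any
   two elements and M is affine.  If |C| >= 5, the absence of shorter circuits
   reduces the class to the three chosen elements, so every circuit meeting C
   contains C and M = C.

   Conversely, each of "any two points lie on a line or any three points lie on
   a 4-circuit without triangles" and "there is at most one circuit" passes to
   induced minors and fails for K4\e and K4. *)
From HB Require Import structures.
From mathcomp Require Import all_boot all_algebra.
Require Import Defs.

Set Implicit Arguments.
Unset Strict Implicit.
Unset Printing Implicit Defensive.

Import GRing.Theory.

(** * Subset sums over GF(2) *)

(** Over GF(2) every element of a span is the sum of a subset. Spans are therefore finite sets of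
    subset sums, sets add by symmetric difference, and most arguments compare cardinals. That a
    class is a union of components is stated as follows: the class part of a relation of M/X is
    again a relation of M/X. In this form it applies to a circuit of M through one element inside
    the class and one outside. The class part sums to an element of <X>, and the cases come from the
    size |C| - 3 of X. For X empty, the class part contradicts the minimality of the circuit. For X
    = {d} it may sum to d, and this is excluded by contracting another element. For larger X, two
    sets with equal sums and fewer than |C| elements in total must coincide; the critical comparison
    is between two pairs, whence the bound five. In the converse, an affine geometry becomes
    projective as soon as something is contracted, so the two properties are carried through minors
    as one disjunction. *)

Section SymmetricDifference.
Variable T : finType.
Implicit Types A B Z : {set T}.

Definition symdiff A B := (A :\: B) :|: (B :\: A).

Lemma in_symdiff A B x : (x \in symdiff A B) = (x \in A) (+) (x \in B).
Proof. by rewrite !inE; case: (x \in A); case: (x \in B). Qed.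

Lemma card_symdiff A B : #|symdiff A B| <= #|A| + #|B|.
Proof.
apply: leq_trans (leq_card_setU _ _) _.
by apply: leq_add; apply: subset_leq_card; apply: subsetDl.
Qed.

Lemma sub_symdiff A B Z : A \subset Z -> B \subset Z -> symdiff A B \subset Z.
Proof.
by move=> sA sB; rewrite subUset !(subset_trans (subsetDl _ _)).
Qed.

Lemma symdiff_setD A Z : Z \subset A -> symdiff Z (A :\: Z) = A.
Proof.
move=> sZA; apply/setP=> x; rewrite in_symdiff inE.
by have := subsetP sZA x; case: (x \in Z) => [->|] //=.
Qed.

Lemma filter_symdiff (p : pred T) A B :
  [set e in symdiff A B | p e] = symdiff [set e in A | p e] [set e in B | p e].
Proof.
by apply/setP=> x; rewrite inE !in_symdiff !inE; case: (p x); rewrite ?andbT ?andbF.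
Qed.

End SymmetricDifference.

Local Open Scope ring_scope.

Lemma F2_cases (x : 'F_2) : x = 0 \/ x = 1.
Proof. by case: x => [] [|[|//]] i; [left | right]; apply: val_inj. Qed.

Ltac char2 := apply/rowP=> ?; rewrite !mxE;
  repeat match goal with |- context [fun_of_matrix ?x ?i ?j] =>
    case: (F2_cases (fun_of_matrix x i j)) => -> end; exact/val_inj.

Section SubsetSums.
Variables (m : nat) (T : finType) (v : T -> 'rV['F_2]_m).
Implicit Types (A B J X Z : {set T}) (x y w : 'rV['F_2]_m).

Lemma addrr_F2 x : x + x = 0.
Proof. by char2. Qed.

Lemma addr_eq0_F2 x y : (x + y == 0) = (x == y).
Proof. by rewrite -{1}[y]opprK subr_eq0 (_ : - y = y) //; char2. Qed.

Definition vsum J := \sum_(e in J) v e.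

Lemma vsum0 : vsum set0 = 0.
Proof. exact: big_set0. Qed.

Lemma vsum1 e : vsum [set e] = v e.
Proof. exact: big_set1. Qed.

Lemma vsumU1 e J : e \notin J -> vsum (e |: J) = v e + vsum J.
Proof. exact: big_setU1. Qed.

Lemma vsum2 e f : e != f -> vsum [set e; f] = v e + v f.
Proof. by move=> nef; rewrite vsumU1 ?inE // vsum1. Qed.

Lemma vsumD1 e J : e \in J -> vsum J = v e + vsum (J :\ e).
Proof. exact: big_setD1. Qed.

Lemma vsum_symdiff A B : vsum (symdiff A B) = vsum A + vsum B.
Proof.
rewrite /vsum [LHS]big_mkcond [X in X + _]big_mkcond [X in _ + X]big_mkcond.
rewrite -big_split; apply: eq_bigr => x _; rewrite in_symdiff.
by case: (x \in A); case: (x \in B); rewrite /= ?addrr_F2 ?addr0 ?add0r.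
Qed.

Lemma vsumD A Z : Z \subset A -> vsum A = vsum Z + vsum (A :\: Z).
Proof. by move=> sZA; rewrite -vsum_symdiff symdiff_setD. Qed.

Definition lspan X : {set 'rV['F_2]_m} := [set vsum J | J in powerset X].

Lemma lspanP X w : reflect (exists2 J : {set T}, J \subset X & w = vsum J) (w \in lspan X).
Proof.
apply: (iffP imsetP) => [[J]|[J sJ ->]]; first by rewrite inE => sJ ->; exists J.
by exists J; rewrite // inE.
Qed.

Lemma lspan_vsum X J : J \subset X -> vsum J \in lspan X.
Proof. by move=> sJ; apply/lspanP; exists J. Qed.

Lemma lspan0 X : 0 \in lspan X.
Proof. by rewrite -vsum0 lspan_vsum ?sub0set. Qed.

Lemma lspanD X x y : x \in lspan X -> y \in lspan X -> x + y \in lspan X.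
Proof.
move=> /lspanP[A sA ->] /lspanP[B sB ->].
by rewrite -vsum_symdiff lspan_vsum ?sub_symdiff.
Qed.

Lemma lspanDr X x y : y \in lspan X -> (x + y \in lspan X) = (x \in lspan X).
Proof.
move=> yX; apply/idP/idP=> [xyX|xX]; last exact: lspanD.
have -> : x = (x + y) + y by char2.
exact: lspanD.
Qed.

Lemma lspan_id X e : e \in X -> v e \in lspan X.
Proof. by move=> eX; rewrite -vsum1 lspan_vsum ?sub1set. Qed.

Lemma lspanU X Z y :
  reflect (exists2 J : {set T}, J \subset Z & y + vsum J \in lspan X) (y \in lspan (X :|: Z)).
Proof.
apply: (iffP idP) => [/lspanP[J sJ ->]|[J sJ]].
  exists (J :\: X); first by rewrite subDset.
  rewrite (vsumD (subsetIl J X)) setDIr setDv set0U -addrA addrr_F2 addr0.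
  by rewrite lspan_vsum ?subsetIr.
move=> /lspanP[A sA E]; have -> : y = vsum A + vsum J by rewrite -E; char2.
apply: lspanD; apply: lspan_vsum.
  exact: subset_trans sA (subsetUl _ _).
exact: subset_trans sJ (subsetUr _ _).
Qed.

End SubsetSums.

Arguments lspanD {m T v X x y}.
Arguments lspanDr {m T v X x y}.

(** * Classes of collinear points in a contraction *)

Section Core.
Variables (m : nat) (T : finType) (v : T -> 'rV['F_2]_m) (E : {set T}).
Implicit Types (A B J X Z D : {set T}) (x y z w : 'rV['F_2]_m).

(* The points of the projective space over V / <X> that survive in the
   simplification of E / X. *)
Definition point X y := (y \notin lspan v X) && [exists e in E, y + v e \in lspan v X].

(** Allowing zero makes equal-or-collinear a single condition on a sum: [b + c] vanishes modulo <X>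
    exactly when [b] and [c] are the same point. *)
Definition point0 X y := (y \in lspan v X) || point X y.

Lemma point_elt X e : e \in E -> v e \notin lspan v X -> point X (v e).
Proof.
by move=> eE neX; rewrite /point neX; apply/exists_inP; exists e; rewrite // addrr_F2 lspan0.
Qed.

Lemma point_shift X y w : w \in lspan v X -> point X (y + w) = point X y.
Proof.
move=> wX; rewrite /point lspanDr //; congr (_ && _); apply: eq_existsb => e; congr (_ && _).
by rewrite addrAC (lspanDr wX).
Qed.

Lemma point0_shift X y w : w \in lspan v X -> point0 X (y + w) = point0 X y.
Proof. by move=> wX; rewrite /point0 point_shift ?lspanDr. Qed.

Lemma point0_elt X y e : e \in E -> y + v e \in lspan v X -> point0 X y.
Proof.
move=> eE yeX; rewrite /point0 /point; case: (y \in lspan v X) => //=.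
by apply/exists_inP; exists e.
Qed.

Lemma point0N X y : point0 X y -> y \notin lspan v X -> point X y.
Proof. by rewrite /point0 => /orP[->|]. Qed.

Lemma point_rep X y : point X y -> exists2 e, e \in E & y + v e \in lspan v X.
Proof. by case/andP=> _ /exists_inP. Qed.

Hypothesis plane : forall X a b c, X \subset E ->
  point X a -> point X b -> point X (a + b) -> point X c -> point X (a + c) ->
  point0 X (b + c).

Section Class.
Variables (X : {set T}) (a0 b0 : 'rV['F_2]_m).
Hypotheses (sXE : X \subset E) (pa0 : point X a0) (pb0 : point X b0)
  (pab0 : point X (a0 + b0)).

Lemma point0_trans a b c : point X a -> point X b -> point X c ->
  point0 X (a + b) -> point0 X (a + c) -> point0 X (b + c).
Proof.
move=> pa pb pc qab qac; have [ab|nab] := boolP (a + b \in lspan v X).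
  have -> : b + c = (a + c) + (a + b) by char2.
  by rewrite point0_shift.
have [ac|nac] := boolP (a + c \in lspan v X).
  have -> : b + c = (a + b) + (a + c) by char2.
  by rewrite point0_shift.
exact: (plane sXE pa pb (point0N qab nab) pc (point0N qac nac)).
Qed.

Definition line_class y := point X y && point0 X (y + a0).

Lemma line_class_point y : line_class y -> point X y.
Proof. by case/andP. Qed.

Lemma line_classN y : line_class y -> y \notin lspan v X.
Proof. by case/andP=> /andP[]. Qed.

Lemma line_class_shift y w : w \in lspan v X -> line_class (y + w) = line_class y.
Proof.
move=> wX; rewrite /line_class addrAC.
by rewrite (point_shift _ wX) (point0_shift _ wX).
Qed.

Lemma line_class_closed y z :
  line_class y -> point X z -> point0 X (y + z) -> line_class z.
Proof.
move=> /andP[py qy] pz qyz; rewrite /line_class pz.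
exact: (point0_trans py).
Qed.

(** By transitivity through [a0] the two points are collinear, so their sum is a point; it is
    collinear with [y], with third point [z]. Together with zero the class is thus a subspace modulo
    <X>. *)
Lemma line_classD y z :
  line_class y -> line_class z -> y + z \notin lspan v X -> line_class (y + z).
Proof.
move=> Ky Kz nyz; have [py qy] := andP Ky; have [pz qz] := andP Kz.
have pyz : point X (y + z).
  by apply: point0N nyz; apply: (point0_trans pa0) => //; rewrite addrC.
apply: (line_class_closed Ky pyz).
by rewrite addrA addrr_F2 add0r /point0 pz orbT.
Qed.

Lemma line_class_rep y : line_class y ->
  exists e, [/\ e \in E, line_class (v e) & y + v e \in lspan v X].
Proof.
move=> Ky; have [e eE yeX] := point_rep (line_class_point Ky); exists e; split=> //.
have -> : v e = y + (y + v e) by char2.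
by rewrite line_class_shift.
Qed.

Lemma line_class_a0 : line_class a0.
Proof. by rewrite /line_class pa0 addrr_F2 /point0 lspan0. Qed.

Lemma line_class_b0 : line_class b0.
Proof. by rewrite /line_class pb0 addrC /point0 pab0 orbT. Qed.

Definition class_part Z := [set e in Z | line_class (v e)].

(* The class of a line is a union of components of E / <X>: every relation
   restricts to a relation on the class. *)
Lemma class_part_relation Z :
  Z \subset E -> vsum v Z \in lspan v X -> vsum v (class_part Z) \in lspan v X.
Proof.
have [n] := ubnP #|Z|; elim: n Z => // n IHn D ltDn sDE DX.
have {IHn} IH Z : Z \subset E -> (#|Z| < #|D|)%N -> vsum v Z \in lspan v X ->
    vsum v (class_part Z) \in lspan v X.
  by move=> sZE ltZ; apply: IHn sZE; apply: leq_trans ltZ _.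
apply/negPn/negP=> nK.
have partS Z : class_part Z \subset Z by apply/subsetP=> e; rewrite inE => /andP[].
have partD A B : vsum v (class_part (symdiff A B)) =
    vsum v (class_part A) + vsum v (class_part B).
  by rewrite /class_part filter_symdiff vsum_symdiff.
(* Otherwise [D] splits into two smaller relations, both satisfy the claim, and their class parts
   add up to that of [D]. *)
have irr Z : Z \subset D -> Z != set0 -> Z != D -> vsum v Z \notin lspan v X.
  move=> sZD nZ0 nZD; apply: contra nK => ZX.
  have DZX : vsum v (D :\: Z) \in lspan v X.
    have -> : vsum v (D :\: Z) = vsum v D + vsum v Z by rewrite (vsumD v sZD); char2.
    exact: lspanD.
  have pZD : Z \proper D by rewrite properEneq nZD.
  rewrite -(symdiff_setD sZD) partD lspanD // IH //.
  - exact: subset_trans sDE.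
  - exact: proper_card.
  - exact: subset_trans (subsetDl _ _) sDE.
  by rewrite cardsDS // ltn_subrL !card_gt0 nZ0; apply: contraNneq nZ0 => D0; rewrite -subset0 -D0.
have [K0|[a aK]] := set_0Vmem (class_part D).
  by rewrite K0 vsum0 lspan0 in nK.
have [aD Ka] : a \in D /\ line_class (v a) by move: aK; rewrite inE => /andP[].
have part1 e : class_part [set e] = if line_class (v e) then [set e] else set0.
  apply/setP=> x; rewrite inE in_set1; case: eqP => [->|/eqP nxe] /=; case: ifP => // _;
  by rewrite ?inE ?eqxx ?(negPf nxe).
(* Two class elements [a], [b] of [D] could be replaced by the third point [g] of their line. This
   shortens the relation and keeps the class sum modulo <X>. *)
have def_K : class_part D = [set a].
  apply/eqP; rewrite eqEsubset sub1set aK andbT; apply/subsetP=> b.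
  rewrite [b \in class_part _]inE => /andP[bD Kb]; rewrite inE; apply/negPn/negP=> nba.
  have s2D : [set a; b] \subset D by rewrite subUset !sub1set aD.
  have nab : a != b by rewrite eq_sym.
  have [eD|nD] := eqVneq [set a; b] D.
    case/negP: nK; suff -> : class_part D = D by [].
    apply/eqP; rewrite eqEsubset partS -{1}eD subUset !sub1set aK inE bD; exact: Kb.
  have abX : v a + v b \notin lspan v X.
    rewrite -vsum2 // irr //; apply/set0Pn; exists a; exact: set21.
  have [g [gE Kg abgX]] := line_class_rep (line_classD Ka Kb abX).
  have E1 : vsum v D = v a + v b + vsum v (D :\: [set a; b]).
    by rewrite (vsumD v s2D) vsum2.
  have E2 : vsum v (class_part D) = v a + v b + vsum v (class_part (D :\: [set a; b])).
    rewrite -{1}(symdiff_setD s2D) partD; congr (_ + _).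
    rewrite -vsum2 //; congr vsum; apply/setP=> x; rewrite !inE.
    by case: eqP => [->|_] //=; case: eqP => [->|].
  have := IH (symdiff [set g] (D :\: [set a; b])).
  rewrite partD part1 Kg vsum_symdiff !vsum1 => H.
  case/negP: nK; rewrite E2.
  have -> : v a + v b + vsum v (class_part (D :\: [set a; b])) =
     (v a + v b + v g) + (v g + vsum v (class_part (D :\: [set a; b]))) by char2.
  apply: (lspanD abgX); apply: H.
  - by apply: sub_symdiff; rewrite ?sub1set // (subset_trans (subsetDl _ _)).
  - apply: leq_ltn_trans (card_symdiff _ _) _.
    rewrite cards1 cardsDS // cards2 nab add1n.
    have := subset_leq_card s2D; rewrite cards2 nab => lt1D.
    by rewrite -subSn // subSS ltn_subrL /= (leq_trans _ lt1D).
  have -> : v g + vsum v (D :\: [set a; b]) = v a + v b + v g + vsum v D.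
    by rewrite E1; char2.
  exact: lspanD.
pose C := D :\ a.
have cardC : #|D| = #|C|.+1 by rewrite (cardsD1 a) aD.
have nKC e : e \in C -> ~~ line_class (v e).
  rewrite 2!inE => /andP[nea eD]; apply: contra nea => Ke.
  by rewrite -in_set1 -def_K inE eD.
have part0 (S : {set T}) : S \subset C -> class_part S = set0.
  move=> sSC; apply/setP=> x; rewrite !inE; apply/negP=> /andP[/(subsetP sSC)/nKC].
  by move/negP.
(* D minus a avoids the class, so a class point that closes up with part of it
   would give a smaller violation. *)
have claim y (S : {set T}) : line_class y -> S \proper C -> y + vsum v S \notin lspan v X.
  move=> Ky pSC; have [g [gE Kg ygX]] := line_class_rep Ky.
  apply/negP=> ySX; have := IH (symdiff [set g] S).
  rewrite partD part1 Kg vsum_symdiff (part0 _ (proper_sub pSC)) vsum0 addr0 !vsum1.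
  move=> H; case/negP: (line_classN Kg); apply: H.
  - rewrite sub_symdiff ?sub1set //.
    by rewrite (subset_trans (proper_sub pSC)) // (subset_trans (subsetDl _ _)).
  - apply: leq_ltn_trans (card_symdiff _ _) _; rewrite cards1 add1n cardC ltnS.
    exact: proper_card.
  have -> : v g + vsum v S = (y + v g) + (y + vsum v S) by char2.
  exact: lspanD.
have ED : vsum v D = v a + vsum v C by rewrite (vsumD1 v aD).
have [C0|[c1 c1C]] := set_0Vmem C.
  by case/negP: (line_classN Ka); rewrite ED C0 vsum0 addr0 in DX.
have EC : vsum v C = v c1 + vsum v (C :\ c1) by rewrite (vsumD1 v c1C).
have [C0|[c2 c2C]] := set_0Vmem (C :\ c1).
  case/negP: (nKC _ c1C); move: DX; rewrite ED EC C0 vsum0 addr0 => acX.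
  have -> : v c1 = v a + (v a + v c1) by char2.
  by rewrite line_class_shift.
(* Modulo X and X', the points a, b, a + b and c1, a + c1 = c2 form two lines
   through a; the plane axiom yields a point d on the line of b and c1. *)
pose X' := C :\ c1 :\ c2.
have EX' : vsum v D = v a + v c1 + v c2 + vsum v X'.
  by rewrite ED EC (vsumD1 v c2C) !addrA.
have c1E : c1 \in E by apply: (subsetP sDE); move: c1C; rewrite !inE => /andP[].
have c2C1 : c2 \in C by move: c2C; rewrite !inE => /andP[].
have c2E : c2 \in E by apply: (subsetP sDE); move: c2C1; rewrite !inE => /andP[].
have sX'C : X' \subset C by apply: subset_trans (subsetDl _ _) (subsetDl _ _).
have sCD : C \subset D by apply: subsetDl.
have properC J : J \subset X' -> (c1 |: J) \proper C.
  move=> sJ; apply/properP; split.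
    by rewrite subUset sub1set c1C (subset_trans sJ).
  exists c2 => //; rewrite !inE negb_or; move: c2C; rewrite !inE => /andP[-> _] /=.
  by apply/negP=> /(subsetP sJ); rewrite !inE eqxx.
have c1J J : J \subset X' -> c1 \notin J.
  by move=> sJ; apply/negP=> /(subsetP sJ); rewrite !inE eqxx andbF.
have properD J : J \subset X' -> J \proper C.
  move=> sJ; apply: sub_proper_trans (properC J sJ); exact: subsetUr.
(* At least one of [a0] and [b0] differs from [a] modulo <X>, because [a0 + b0] is nonzero there. *)
have [b [bE Kb abX]] : exists b, [/\ b \in E, line_class (v b) & v a + v b \notin lspan v X].
  have [y Ky ay] : exists2 y, line_class y & v a + y \notin lspan v X.
    have [aa0|] := boolP (v a + a0 \in lspan v X); last by exists a0 => //; exact: line_class_a0.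
    exists b0; first exact: line_class_b0.
    apply: contraTN pab0 => ab0; rewrite /point negb_and negbK.
    have -> : a0 + b0 = (v a + a0) + (v a + b0) by char2.
    by rewrite lspanD.
  have [b [bE Kb yb]] := line_class_rep Ky; exists b; split=> //.
  have -> : v a + v b = (v a + y) + (y + v b) by char2.
  by rewrite lspanDr.
have Kab := line_classD Ka Kb abX.
have sX2 : X :|: X' \subset E.
  by rewrite subUset sXE (subset_trans sX'C) // (subset_trans sCD).
have subX w : w \in lspan v X -> w \in lspan v (X :|: X').
  by move=> wX; apply/lspanU; exists set0; rewrite ?sub0set // vsum0 addr0.
(* By [claim], contracting [X'] as well does not send a class point to zero. *)
have pK y : line_class y -> point (X :|: X') y.
  move=> Ky; rewrite /point; apply/andP; split.
    by apply/lspanU=> -[J sJ]; apply/negP; apply: claim => //; apply: properD.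
  have [e eE yeX] := point_rep (line_class_point Ky).
  by apply/exists_inP; exists e => //; apply: subX.
have irrc1 J : J \subset X' -> v c1 + vsum v J \notin lspan v X.
  move=> sJ; rewrite -vsumU1 ?c1J // irr //.
  - by apply: subset_trans (proper_sub (properC _ sJ)) sCD.
  - by apply/set0Pn; exists c1; rewrite setU11.
  apply: contraTneq (subset_leq_card (proper_sub (properC _ sJ))) => ->.
  by rewrite cardC -ltnNge.
have pc1 : point (X :|: X') (v c1).
  apply: point_elt => //; apply/lspanU=> -[J sJ]; apply/negP; exact: irrc1.
have pac1 : point (X :|: X') (v a + v c1).
  rewrite /point; apply/andP; split.
    apply/lspanU=> -[J sJ]; rewrite -addrA -vsumU1 ?c1J //; apply/negP.
    by apply: claim => //; apply: properC.
  apply/exists_inP; exists c2 => //.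
  apply/lspanU; exists X' => //; by rewrite -EX'.
have := plane sX2 (pK _ Ka) (pK _ Kb) (pK _ Kab) pc1 pac1.
case/orP=> [/lspanU[J sJ]|/point_rep[d dE /lspanU[J sJ]]].
  rewrite -addrA -vsumU1 ?c1J //; apply/negP; apply: claim => //; exact: properC.
(* If [d] is in the class, then [b + d] is zero or a class point, and [c1] with [J] contradicts
   [irrc1] or [claim]. *)
move=> HJ; have [Kd|nKd] := boolP (line_class (v d)).
  have E1 : v b + v c1 + v d + vsum v J = v b + v d + vsum v (c1 |: J).
    by rewrite vsumU1 ?c1J //; char2.
  have [bd|nbd] := boolP (v b + v d \in lspan v X).
    case/negP: (irrc1 _ sJ).
    have -> : v c1 + vsum v J = (v b + v c1 + v d + vsum v J) + (v b + v d) by char2.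
    by rewrite lspanD.
  move: HJ; rewrite E1; apply/negP; apply: claim (properC _ sJ); exact: line_classD.
(* For [J = X'], adding the relation [D] leaves [a + b + c2 + d], which makes [c2] equal to or
   collinear with the class point [a + b]. *)
have [eJ|nJ] := eqVneq J X'.
  case/negP: (nKC _ c2C1); apply: (line_class_closed Kab).
    apply: point_elt => //; rewrite -vsum1 irr //.
    - by rewrite sub1set (subsetP sCD).
    - by apply/set0Pn; exists c2; rewrite inE.
    apply: contraTneq aD => <-; rewrite inE.
    by move: c2C1; rewrite !inE eq_sym => /andP[].
  apply: (point0_elt dE).
  have -> : v a + v b + v c2 + v d = (v b + v c1 + v d + vsum v J) + vsum v D.
    by rewrite EX' eJ; char2.
  exact: lspanD.
(* A proper subset [J] of [X'] gives a relation shorter than [D] whose class part is [b] alone. *)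
have := IH (symdiff [set b] (symdiff [set d] (c1 |: J))).
rewrite !partD !part1 Kb (negPf nKd) (part0 _ (proper_sub (properC _ sJ))).
rewrite !vsum_symdiff !vsum0 !addr0 !vsum1 vsumU1 ?c1J // => H.
case/negP: (line_classN Kb); apply: H.
- rewrite !sub_symdiff ?sub1set //.
  by rewrite (subset_trans (proper_sub (properC _ sJ))) // (subset_trans sCD).
- apply: leq_ltn_trans (card_symdiff _ _) _; rewrite cards1.
  apply: leq_ltn_trans (leq_add (leqnn 1) (card_symdiff _ _)) _.
  rewrite cards1 cardsU1 c1J // cardC (cardsD1 c1 C) c1C (cardsD1 c2 (C :\ c1)) c2C.
  rewrite !add1n !ltnS; apply: proper_card; by rewrite properEneq nJ.
by have -> : v b + (v d + (v c1 + vsum v J)) = v b + v c1 + v d + vsum v J by char2.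
Qed.

End Class.

End Core.

(** * The classification for vector configurations *)

Section Classification.
Variables (m : nat) (T : finType) (v : T -> 'rV['F_2]_m) (E : {set T}).
Implicit Types (A B J X Z D : {set T}) (x y z w : 'rV['F_2]_m).

Lemma lspan_set0 w : w \in lspan v set0 -> w = 0.
Proof. by case/lspanP=> J; rewrite subset0 => /eqP-> ->; rewrite vsum0. Qed.

Lemma lspan_set1 d w : w \in lspan v [set d] -> w = 0 \/ w = v d.
Proof.
case/lspanP=> J; rewrite subset1 => /orP[]/eqP-> ->.
  by right; rewrite vsum1.
by left; rewrite vsum0.
Qed.

Lemma set2_neq1 (e f g : T) : e != f -> [set e; f] <> [set g].
Proof. by move=> nef /(congr1 (fun A : {set T} => #|A|)); rewrite cards2 cards1 nef. Qed.

Hypothesis plane : forall X a b c, X \subset E ->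
  point v E X a -> point v E X b -> point v E X (a + b) -> point v E X c ->
  point v E X (a + c) -> point0 v E X (b + c).

Hypothesis simple : forall Z, Z \subset E -> vsum v Z = 0 -> Z != set0 -> (2 < #|Z|)%N.

Hypothesis connected : forall e f, e \in E -> f \in E -> e != f ->
  exists D, [/\ D \subset E, e \in D, f \in D, vsum v D = 0 &
    forall Z, Z \subset D -> vsum v Z = 0 -> Z = set0 \/ Z = D].

Section ShortestCircuit.
Variable C : {set T}.
Hypotheses (sCE : C \subset E) (C0 : vsum v C = 0) (nC : C != set0)
  (minC : forall Z, Z \subset E -> vsum v Z = 0 -> Z != set0 -> (#|C| <= #|Z|)%N).

(** The symmetric difference is a relation with fewer elements than the shortest circuit, hence
    empty. *)
Lemma short_relation A B : A \subset E -> B \subset E -> vsum v A = vsum v B ->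
  (#|A| + #|B| < #|C|)%N -> A = B.
Proof.
move=> sA sB eAB ltC; apply/setP=> x.
have s0 : symdiff A B = set0.
  apply/eqP; apply: contraTT ltC => nAB; rewrite -leqNgt.
  apply: leq_trans (card_symdiff A B); apply: minC nAB; first exact: sub_symdiff.
  by rewrite vsum_symdiff eAB addrr_F2.
by have /setP/(_ x) := s0; rewrite in_symdiff in_set0; do 2 case: (x \in _).
Qed.

Lemma elt_notin_lspan X e : X \subset E -> (#|X|.+1 < #|C|)%N -> e \in E ->
  e \notin X -> v e \notin lspan v X.
Proof.
move=> sXE ltX eE neX; apply/lspanP=> -[J sJ]; rewrite -vsum1 => eJ.
case/negP: neX; rewrite -sub1set (short_relation _ _ eJ) ?sub1set //.
  exact: subset_trans sXE.
by rewrite cards1 add1n (leq_ltn_trans _ ltX) // ltnS subset_leq_card.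
Qed.

Lemma elt_inj e f : e \in E -> f \in E -> v e = v f -> e = f.
Proof.
move=> eE fE ef; apply: set1_inj; apply: short_relation.
- by rewrite sub1set.
- by rewrite sub1set.
- by rewrite !vsum1.
by rewrite !cards1; apply: (simple sCE C0 nC).
Qed.

Section Triangle.
Variables (a b c : T).
Hypotheses (aC : a \in C) (bC : b \in C) (cC : c \in C)
  (nab : a != b) (nac : a != c) (nbc : b != c).

Let X := C :\ a :\ b :\ c.

Let sXC : X \subset C.
Proof.
apply: subset_trans (subsetDl _ _) _.
exact: subset_trans (subsetDl _ _) (subsetDl _ _).
Qed.

Let sXE : X \subset E. Proof. exact: subset_trans sXC sCE. Qed.

Let aE : a \in E. Proof. exact: (subsetP sCE). Qed.
Let bE : b \in E. Proof. exact: (subsetP sCE). Qed.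
Let cE : c \in E. Proof. exact: (subsetP sCE). Qed.

Lemma card_three : #|C| = #|X|.+3.
Proof.
rewrite (cardsD1 a) aC (cardsD1 b (C :\ a)) !inE eq_sym nab bC.
by rewrite (cardsD1 c (C :\ a :\ b)) !inE eq_sym nbc eq_sym nac cC.
Qed.

Lemma vsum_three : v a + v b + v c = vsum v X.
Proof.
have : vsum v C = v a + v b + v c + vsum v X.
  rewrite (vsumD1 v aC) (@vsumD1 _ _ v b) ?inE 1?eq_sym ?nab ?bC //.
  by rewrite (@vsumD1 _ _ v c) ?inE 1?eq_sym ?nbc 1?eq_sym ?nac ?cC // !addrA.
by rewrite C0 => /esym/eqP; rewrite addr_eq0_F2 => /eqP.
Qed.

Let ltXC : (#|X|.+1 < #|C|)%N. Proof. by rewrite card_three. Qed.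

Let aX : a \notin X. Proof. by rewrite !inE eqxx ?andbF. Qed.
Let bX : b \notin X. Proof. by rewrite !inE eqxx ?andbF. Qed.
Let cX : c \notin X. Proof. by rewrite !inE eqxx ?andbF. Qed.

Let pE e : e \in E -> e \notin X -> point v E X (v e).
Proof. by move=> eE eX; apply: point_elt => //; apply: elt_notin_lspan. Qed.

Let pab : point v E X (v a + v b).
Proof.
have -> : v a + v b = v c + vsum v X by rewrite -vsum_three; char2.
by rewrite point_shift ?lspan_vsum // pE.
Qed.

Local Notation K := (line_class v E X (v a)).

Let relation Z : Z \subset E -> vsum v Z = 0 ->
  vsum v [set e in Z | K (v e)] \in lspan v X.
Proof.
move=> sZ Z0; apply: (class_part_relation plane sXE (pE aE aX) (pE bE bX) pab sZ).
by rewrite Z0 lspan0.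
Qed.

Let Ka : K (v a). Proof. by rewrite /line_class pE // addrr_F2 /point0 lspan0. Qed.

(** With [X] empty, a circuit through [a] and an element outside the class would properly contain a
    nonempty relation, namely its class part. So every element is in the class. *)
Lemma girth3 : #|C| = 3 -> forall e f, e \in E -> f \in E -> e != f ->
  exists2 g, g \in E & v e + v f + v g = 0.
Proof.
rewrite card_three => -[/eqP]; rewrite cards_eq0 => /eqP X0.
have inK (y : T) : y \in E -> K (v y).
  move=> yE; apply/negPn/negP=> nKy.
  have nay : a != y by apply: contraNneq nKy => <-.
  have [D [sDE aD yD D0 irrD]] := connected aE yE nay.
  have := relation sDE D0; rewrite X0 => /lspan_set0/irrD[|/setP|/setP].
  - by apply/subsetP=> z; rewrite inE => /andP[].
  - by move/(_ a); rewrite -{1}X0 inE aD Ka inE.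
  by move/(_ y); rewrite -{1}X0 inE yD (negPf nKy).
move=> e f eE fE nef; have Ke := inK e eE; have Kf := inK f fE.
have [pe qe] := andP Ke; have [pf qf] := andP Kf.
have : point0 v E X (v e + v f).
  by apply: (point0_trans plane sXE (pE aE aX)); rewrite // addrC.
rewrite /point0 X0 => /orP[/lspan_set0/eqP|/point_rep[g gE /lspan_set0]].
  by rewrite addr_eq0_F2 => /eqP/(elt_inj eE fE)/eqP; rewrite (negPf nef).
by exists g.
Qed.

(** Once everything but [d] is in the class, any two elements lie on a line modulo [d]. Since there
    are no triangles, this line comes from a 4-circuit through [d]. *)
Lemma girth4 : #|C| = 4 -> forall e f g, e \in E -> f \in E -> g \in E ->
  exists2 h, h \in E & v e + v f + v g + v h = 0.
Proof.
move=> C4; have /eqP/cards1P[d Xd] : #|X| = 1 by move: C4; rewrite card_three => -[].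
have dX : d \in X by rewrite Xd inE.
have dE : d \in E by apply: (subsetP sXE).
have nda : d != a by apply: contraNneq aX => <-.
have abcd : v a + v b + v c = v d by rewrite vsum_three Xd vsum1.
have inX (z : T) : z != d -> z \notin X by rewrite Xd inE.
have inj2 e f : e \in E -> f \in E -> e != f -> v e + v f != 0.
  by move=> eE fE; apply: contra; rewrite addr_eq0_F2 => /eqP/(elt_inj eE fE)->.
have no_triangle e f g : e \in E -> f \in E -> g \in E -> e != f -> v e + v f != v g.
  move=> eE fE gE nef; apply/negP=> /eqP efg; apply: (@set2_neq1 e f g) => //.
  apply: short_relation; rewrite ?subUset ?sub1set ?eE ?vsum2 ?vsum1 //.
  by rewrite cards2 nef cards1 C4.
have inK (y : T) : y \in E -> y != d -> K (v y).
  move=> yE nyd; apply/negPn/negP=> nKy.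
  have nay : a != y by apply: contraNneq nKy => <-.
  have [D [sDE aD yD D0 irrD]] := connected aE yE nay.
  pose D1 := [set e in D | K (v e)].
  have sD1 : D1 \subset D by apply/subsetP=> z; rewrite inE => /andP[].
  have aD1 : a \in D1 by rewrite inE aD.
  have yD1 : y \notin D1 by rewrite inE yD.
  (* Sum zero is impossible: the class part would be a proper nonempty relation inside the circuit
     [D]. *)
  have D1d : vsum v D1 = v d.
    have := relation sDE D0; rewrite -/D1 Xd => /lspan_set1[|//].
    case/(irrD _ sD1)=> /setP.
      by move/(_ a); rewrite aD1 inE.
    by move/(_ y); rewrite (negPf yD1) yD.
  (* D splits modulo d into D1 inside the class and D2 outside it, and D2 with d
     is a relation; contracting a instead of d, the class of the line through d
     and b meets that relation in d alone. *)
  pose D2 := D :\: D1.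
  have D2d : vsum v D2 = v d.
    have := vsumD v sD1; rewrite D0 D1d -/D2 => /esym/eqP; rewrite addr_eq0_F2.
    by move/eqP->.
  have sD2 : D2 \subset D by apply: subsetDl.
  (* Otherwise [D2] without [d] would be a relation inside [D] that contains [y] and misses [a]. *)
  have dD2 : d \notin D2.
    apply/negP=> dD2; have := vsumD1 v dD2; rewrite D2d => /eqP.
    rewrite eq_sym -{2}[v d]addr0 (inj_eq (addrI _)) => /eqP/irrD[|/setP/(_ y)|/setP/(_ a)].
    - by apply: subset_trans (subsetDl _ _) sD2.
    - by rewrite !inE nyd yD andbT /= => /negbT; rewrite negbK => Ky; rewrite Ky in nKy.
    by rewrite aD [a \in _]in_setD1 in_setD aD1 andbF.
  have lt1 : (#|[set a]|.+1 < #|C|)%N by rewrite cards1 C4.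
  have sa : [set a] \subset E by rewrite sub1set.
  have pEa e : e \in E -> e != a -> point v E [set a] (v e).
    move=> eE nea; apply: point_elt => //.
    by apply: elt_notin_lspan; rewrite // inE.
  have pdb : point v E [set a] (v d + v b).
    have -> : v d + v b = v c + v a by rewrite -abcd; char2.
    by rewrite point_shift ?lspan_id ?set11 // pEa // eq_sym.
  have := class_part_relation plane sa (pEa d dE nda) _ pdb.
  rewrite (pEa b bE); last by rewrite eq_sym.
  move=> /(_ isT (d |: D2)); rewrite vsumU1 // D2d addrr_F2 lspan0 subUset sub1set dE.
  rewrite (subset_trans sD2 sDE) => /(_ isT isT).
  rewrite (_ : class_part _ _ _ _ _ = [set d]).
    rewrite vsum1 => /lspan_set1[d0|/(elt_inj dE aE)/eqP]; last by rewrite (negPf nda).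
    by have := inj2 d a dE aE nda; have := pEa d dE nda; rewrite /point d0 lspan0.
  apply/setP=> z; rewrite in_set1 [LHS]inE in_setU1.
  have [->|nzd] /= := eqVneq z d.
    by rewrite /line_class pEa // addrr_F2 /point0 lspan0.
  apply/negP=> /andP[zD2 /andP[_ q]].
  have zE : z \in E by apply: (subsetP sDE); apply: (subsetP sD2).
  have zd := inj2 z d zE dE nzd.
  (* Three outcomes give equal elements or a triangle. The last one, [z + d + e = a], says that [z],
     [a], [e] close up modulo [d], so [z] would be in the class that [D2] avoids. *)
  case/orP: q => [/lspan_set1[/eqP|/eqP]|/point_rep[e eE /lspan_set1[/eqP|zdea]]].
  - by rewrite (negPf zd).
  - by rewrite (negPf (no_triangle z d a zE dE aE nzd)).
  - by rewrite addr_eq0_F2 (negPf (no_triangle z d e zE dE eE nzd)).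
  have zD : z \in D by apply: (subsetP sD2).
  move: zD2; rewrite inE zD andbT inE zD /= => /negP; apply.
  rewrite /line_class pE ?inX //=; apply: (point0_elt (e := e) eE).
  have -> : v z + v a + v e = v d by rewrite -zdea; char2.
  by rewrite Xd lspan_id ?set11.
have pair e f : e \in E -> f \in E -> exists2 h, h \in E & v e + v f + v d + v h = 0.
  move=> eE fE; have [->|ned] := eqVneq e d; first by exists f => //; char2.
  have [->|nfd] := eqVneq f d; first by exists e => //; char2.
  have [->|nef] := eqVneq e f; first by exists d => //; char2.
  have Ke := inK e eE ned; have Kf := inK f fE nfd.
  have [pe qe] := andP Ke; have [pf qf] := andP Kf.
  have : point0 v E X (v e + v f).
    by apply: (point0_trans plane sXE (pE aE aX)); rewrite // addrC.
  rewrite {1}Xd => /orP[/lspan_set1[/eqP|/eqP]|/point_rep[g gE]].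
  - by rewrite (negPf (inj2 _ _ eE fE nef)).
  - by rewrite (negPf (no_triangle _ _ _ eE fE dE nef)).
  case/lspan_set1=> [/eqP|efgd].
    by rewrite addr_eq0_F2 (negPf (no_triangle _ _ _ eE fE gE nef)).
  by exists g => //; rewrite -efgd; char2.
(* With [h = e + f + d] and [k = h + g + d], both [h] and [d] cancel and [k = e + f + g]. *)
move=> e f g eE fE gE; have [h hE efh] := pair e f eE fE.
have [k kE hgk] := pair h g hE gE; exists k => //.
have -> : v e + v f + v g + v k = (v e + v f + v d + v h) + (v h + v g + v d + v k).
  by char2.
by rewrite efh hgk addr0.
Qed.

(** A further class element [e] cannot equal [a] modulo <X>, by counting, so it is collinear with
    [a] through some [g]. Counting again forces the subset of [X] in this relation to be all of [X].
    Comparison with [a + b + c] gives [e + g = b + c], and these two pairs coincide when |C| exceeds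
    four. *)
Lemma triple_class e : (4 < #|C|)%N -> e \in E -> K (v e) -> e \in [set a; b; c].
Proof.
move=> C5 eE Ke; apply/negPn/negP; rewrite !inE !negb_or => /andP[/andP[nea neb] nec].
have [pe qe] := andP Ke; have ea2 : [set e; a] \subset E by rewrite subUset !sub1set eE.
have sJE J : J \subset X -> J \subset E by move=> sJ; apply: subset_trans sXE.
case/orP: qe => [/lspanP[J sJ]|/point_rep[g gE /lspanP[J sJ]]].
  rewrite -vsum2 // => /(short_relation ea2 (sJE _ sJ)) eJ.
  case/negP: aX; apply: (subsetP sJ); rewrite -eJ ?set22 //.
  rewrite cards2 nea card_three.
  by apply: leq_ltn_trans (leq_add (leqnn 2) (subset_leq_card sJ)) _.
move=> eJ.
have nge : g != e.
  apply: contraTneq (lspan_vsum v sJ) => ge; rewrite -eJ ge.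
  have -> : v e + v a + v e = v a by char2.
  exact: elt_notin_lspan.
have nga : g != a.
  apply: contraTneq (lspan_vsum v sJ) => ga; rewrite -eJ ga.
  have -> : v e + v a + v a = v e by char2.
  by case/andP: pe.
have eJ3 : vsum v (g |: [set e; a]) = vsum v J.
  by rewrite vsumU1 ?inE ?negb_or ?nge // vsum2 // -eJ; char2.
have c3 : #|g |: [set e; a]| = 3 by rewrite cardsU1 !inE negb_or nge nga cards2 nea.
have s3 : g |: [set e; a] \subset E by rewrite subUset sub1set gE.
(* The three elements and [J] together stay below |C| = |X| + 3 exactly when [J] is a proper subset
   of [X]. *)
have [JX|nJX] := eqVneq J X; last first.
  case/negP: aX; apply: (subsetP sJ); rewrite -(short_relation s3 (sJE _ sJ) eJ3).
    by rewrite !inE eqxx !orbT.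
  by rewrite c3 card_three !addSn add0n !ltnS proper_card // properEneq nJX.
have neg : e != g by rewrite eq_sym.
have egbc : vsum v [set e; g] = vsum v [set b; c].
  rewrite !vsum2 //; have := vsum_three; rewrite -JX -eJ => abc.
  have -> : v e + v g = v a + (v e + v a + v g) by char2.
  by rewrite -abc; char2.
have eg2 : [set e; g] \subset E by rewrite subUset !sub1set eE.
have bc2 : [set b; c] \subset E by rewrite subUset !sub1set bE.
have /setP/(_ e) : [set e; g] = [set b; c].
  by apply: short_relation; rewrite // !cards2 neg nbc.
by rewrite !inE eqxx (negPf neb) (negPf nec).
Qed.

(** Without [b] the class part of [D] lies in [{a, c}] and has the sum of a subset of [X]. The two
    sets have at most |C| - 1 elements together, so they coincide and [a] would lie in [X]. *)
Lemma triple_in_circuit D : (4 < #|C|)%N -> D \subset E -> vsum v D = 0 ->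
  a \in D -> b \in D.
Proof.
move=> C5 sDE D0 aD; apply/negPn/negP=> nbD.
have [J sJ eJ] := lspanP _ _ _ (relation sDE D0).
have sK : [set e in D | K (v e)] \subset [set a; c].
  apply/subsetP=> e; rewrite inE => /andP[eD Ke].
  have := triple_class C5 (subsetP sDE e eD) Ke; rewrite !inE.
  by have [eb|] := eqVneq e b; [rewrite eb (negPf nbD) in eD | rewrite orbF].
case/negP: aX; apply: (subsetP sJ); rewrite -(short_relation _ _ eJ).
- by rewrite inE aD Ka.
- by apply: subset_trans sDE; apply/subsetP=> e; rewrite inE => /andP[].
- exact: subset_trans sXE.
apply: leq_ltn_trans (leq_add (subset_leq_card sK) (subset_leq_card sJ)) _.
by rewrite cards2 nac card_three.
Qed.

End Triangle.

Lemma girth5 : (4 < #|C|)%N -> E = C.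
Proof.
move=> C5; apply/eqP; rewrite eqEsubset sCE andbT; apply/subsetP=> y yE.
apply/negPn/negP=> nyC; have [a aC] := set0Pn _ nC.
have aE := subsetP sCE a aC; have nay : a != y by apply: contraNneq nyC => <-.
have [D [sDE aD yD D0 irrD]] := connected aE yE nay.
have sCD : C \subset D.
  apply/subsetP=> b bC; have [->//|nba] := eqVneq b a.
  have /set0Pn[c] : C :\ a :\ b != set0.
    rewrite -card_gt0 -(ltn_add2l 2) [X in (_ < X)%N](_ : _ = #|C|); first exact: ltnW (ltnW C5).
    by rewrite [RHS](cardsD1 a) aC (cardsD1 b (C :\ a)) !inE nba bC.
  rewrite !inE => /and3P[ncb nca cC].
  by apply: (triple_in_circuit aC bC cC _ _ _ C5 sDE D0 aD); rewrite // eq_sym.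
have [C1|CD] := irrD C sCD C0; first by case/eqP: nC.
by rewrite CD yD in nyC.
Qed.

End ShortestCircuit.

Lemma classification :
  [\/ forall e f, e \in E -> f \in E -> e != f ->
        exists2 g, g \in E & v e + v f + v g = 0,
      (forall e f g, e \in E -> f \in E -> g \in E ->
         exists2 h, h \in E & v e + v f + v g + v h = 0) /\
      (exists I : {set T}, [/\ I \subset E, #|I| = 3 &
         forall Z, Z \subset I -> vsum v Z = 0 -> Z = set0])
    | [/\ vsum v E = 0, forall Z, Z \subset E -> vsum v Z = 0 -> Z = set0 \/ Z = E
        & (2 < #|E|)%N]].
Proof.
pose circ (Z : {set T}) := [&& Z \subset E, vsum v Z == 0 & Z != set0].
have [/existsP[C1 circ1]|no_circ] := boolP [exists Z, circ Z]; last first.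
  (* Without circuits, connectivity leaves at most one element: these are the projective geometries
     of rank 0 and 1. *)
  constructor 1=> e f eE fE nef; case/negP: no_circ; apply/existsP.
  have [D [sD eD _ D0 _]] := connected eE fE nef.
  by exists D; rewrite /circ sD D0 eqxx; apply/set0Pn; exists e.
have [C /and3P[sCE /eqP C0 nC] minC1] := arg_minnP (fun Z : {set T} => #|Z|) circ1.
have minC Z : Z \subset E -> vsum v Z = 0 -> Z != set0 -> (#|C| <= #|Z|)%N.
  by move=> sZ Z0 nZ; apply: minC1; rewrite /circ sZ Z0 eqxx.
have C3 := simple sCE C0 nC.
have [a aC] := set0Pn _ nC.
have Ca : (1 < #|C :\ a|)%N by move: C3; rewrite (cardsD1 a) aC.
have /set0Pn[b bCa] : C :\ a != set0 by rewrite -card_gt0 ltnW.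
have /set0Pn[c cCab] : C :\ a :\ b != set0.
  by rewrite -card_gt0; move: Ca; rewrite (cardsD1 b) bCa.
move: bCa cCab; rewrite !inE => /andP[nba bC] /and3P[ncb nca cC].
rewrite eq_sym in nba; rewrite eq_sym in nca; rewrite eq_sym in ncb.
have [C5|] := ltnP 4 #|C|.
  constructor 3; rewrite (girth5 sCE C0 nC minC C5); split=> // Z sZ Z0.
  have [->|nZ] := eqVneq Z set0; [by left | right].
  apply/eqP; rewrite eqEcard sZ minC //; exact: subset_trans sCE.
rewrite leq_eqVlt => /orP[/eqP C4|C4].
  constructor 2; split; first exact: (girth4 sCE C0 nC minC aC bC cC).
  (* Three elements of a shortest circuit of size four are independent; they later give the bound on
     the rank. *)
  exists [set a; b; c]; rewrite !subUset !sub1set !(subsetP sCE) //.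
  have c3 : #|[set a; b; c]| = 3.
    by rewrite setUC cardsU1 !inE negb_or ![c == _]eq_sym nca ncb cards2 nba.
  split=> // Z sZ Z0; apply/eqP/negPn/negP=> nZ.
  have sZE : Z \subset E.
    by apply: subset_trans sZ _; rewrite !subUset !sub1set !(subsetP sCE).
  by have := leq_trans (minC Z sZE Z0 nZ) (subset_leq_card sZ); rewrite C4 c3.
constructor 1; apply: (girth3 sCE C0 nC minC aC bC cC) => //.
by apply/eqP; rewrite eqn_leq C3 andbT.
Qed.

End Classification.

(** * Matroids represented modulo a subspace *)

Section SpanF2.
Variables (V : vectType 'F_2) (T : finType) (v : T -> V).
Implicit Types I J : {set T}.

Lemma span_subset_sum I w :
  reflect (exists2 J : {set T}, J \subset I & w = \sum_(e in J) v e)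
          (w \in <<[seq v e | e <- enum I]>>%VS).
Proof.
apply: (iffP idP) => [|[J sJI ->]]; last first.
  apply: memv_suml => e eJ; apply: memv_span; apply: map_f.
  by rewrite mem_enum (subsetP sJI).
have [n] := ubnP #|I|; elim: n I w => // n IHn I w ltn.
have [->|[e eI]] := set_0Vmem I.
  by rewrite enum_set0 span_nil memv0 => /eqP->; exists set0; rewrite ?sub0set ?big_set0.
have -> : <<[seq v e | e <- enum I]>>%VS = <<v e :: [seq v e | e <- enum (I :\ e)]>>%VS.
  apply: eq_span => x; rewrite -map_cons; apply: perm_mem; apply: perm_map.
  by rewrite -{1}(setD1K eI); apply: enum_setU1; rewrite setD11.
rewrite span_cons => /memv_addP[_ /vlineP[k ->] [u uI ->]].
have [|J sJ ->] := IHn (I :\ e) u _ uI.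
  by move: ltn; rewrite (cardsD1 e I) eI.
have sJI : J \subset I := subset_trans sJ (subsetDl _ _).
case: (F2_cases k) => ->; first by exists J; rewrite // scale0r add0r.
exists (e |: J); first by rewrite subUset sub1set eI.
rewrite big_setU1 ?scale1r //; apply/negP=> /(subsetP sJ).
by rewrite setD11.
Qed.

Lemma free_subset_sum I :
  reflect (forall J, J \subset I -> \sum_(e in J) v e = 0 -> J = set0)
          (free [seq v e | e <- enum I]).
Proof.
have double (x : V) : x + x = 0.
  by rewrite -[x]scale1r -scalerDl (_ : 1 + 1 = 0) ?scale0r //; apply/val_inj.
have freeD1 e J : e \in J -> free [seq v e | e <- enum J] =
    (v e \notin <<[seq v e | e <- enum (J :\ e)]>>%VS) && free [seq v e | e <- enum (J :\ e)].
  move=> eJ; rewrite -free_cons -map_cons; apply: perm_free; apply: perm_map.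
  by rewrite -{1}(setD1K eJ); apply: enum_setU1; rewrite setD11.
apply: (iffP idP) => [freeI J sJI J0|].
  apply/eqP/negPn/negP=> /set0Pn[e eJ].
  have := freeI; rewrite (freeD1 e) ?(subsetP sJI) // => /andP[/span_subset_sum[]].
  exists (J :\ e); first exact: setSD.
  by apply: (@addIr _ (\sum_(i in J :\ e) v i)); rewrite double; move: J0; rewrite (big_setD1 e).
have [n] := ubnP #|I|; elim: n I => // n IHn I ltn H.
have [->|[e eI]] := set_0Vmem I; first by rewrite enum_set0 nil_free.
rewrite (freeD1 e) // IHn ?andbT.
- apply/negP=> /span_subset_sum[J sJ eJ].
  have neJ : e \notin J by apply/negP=> /(subsetP sJ); rewrite setD11.
  have /setP/(_ e) : e |: J = set0.
    apply: H; last by rewrite big_setU1 //= eJ double.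
    by rewrite subUset sub1set eI (subset_trans sJ (subsetDl _ _)).
  by rewrite setU11 inE.
- by move: ltn; rewrite (cardsD1 e I) eI.
by move=> J sJ; apply: H; apply: subset_trans sJ (subsetDl _ _).
Qed.

End SpanF2.

Section Representation.
Variables (m : nat) (T : finType) (v : T -> 'rV['F_2]_m).
Implicit Types (A B I J X Z F S : {set T}) (W U : {set 'rV['F_2]_m}).

Definition subgroup_F2 W := 0 \in W /\ forall x y, x \in W -> y \in W -> x + y \in W.

Lemma subgroup_F2_0 : subgroup_F2 [set 0].
Proof. by split=> [|x y]; rewrite !inE // => /eqP-> /eqP->; rewrite addr0. Qed.

Lemma subgroup_F2_lspan X : subgroup_F2 (lspan v X).
Proof. by split=> [|x y]; [exact: lspan0 | exact: lspanD]. Qed.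

Lemma subgroup_F2_vsum W J : subgroup_F2 W -> (forall e, e \in J -> v e \in W) ->
  vsum v J \in W.
Proof. by case=> W0 WD sJW; apply: (big_ind (fun x => x \in W)). Qed.

(* The vectors are read modulo W, so that contraction only enlarges W. *)
Definition represents (M : matroid T) W := forall I,
  I \in indep M <->
  I \subset ground M /\ forall J, J \subset I -> vsum v J \in W -> J = set0.

Lemma represents_vector (M : matroid T) :
  indep M = indep (vector_matroid (ground M) v) -> represents M [set 0].
Proof.
move=> eM I; rewrite eM inE; apply: (iff_trans (iff_sym (rwP andP))).
split=> [[sI /free_subset_sum fI]|[sI fI]].
  by split=> // J sJ; rewrite inE => /eqP; apply: fI.
by split=> //; apply/free_subset_sum => J sJ J0; apply: fI; rewrite // inE; apply/eqP.
Qed.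

Lemma represents_restrict (M : matroid T) W X :
  represents M W -> represents (restrict M X) W.
Proof.
move=> rM I; rewrite inE; apply: (iff_trans (iff_sym (rwP andP))).
split=> [[/rM[sI fI] sX]|[/=]].
  by split; rewrite //= subsetI sI.
by rewrite subsetI => /andP[sI sX] fI; split=> //; apply/rM.
Qed.

(** This is W + <X>: in characteristic 2 the condition says that [w] and [vsum v J] agree modulo
    [W]. *)
Definition wspan W X := [set w | [exists J : {set T}, (J \subset X) && (w + vsum v J \in W)]].

Lemma wspanP W X w :
  reflect (exists2 J : {set T}, J \subset X & w + vsum v J \in W) (w \in wspan W X).
Proof. by rewrite inE; apply: exists_inP. Qed.

Lemma wspan0 X : wspan [set 0] X = lspan v X.
Proof.
apply/setP=> w; apply/wspanP/lspanP=> -[J sJ].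
  by rewrite inE addr_eq0_F2 => /eqP->; exists J.
by move=> ->; exists J; rewrite // inE addrr_F2.
Qed.

Section Subgroup.
Variable W : {set 'rV['F_2]_m}.
Hypothesis sgW : subgroup_F2 W.

Lemma subgroup_F2_addr x y : y \in W -> (x + y \in W) = (x \in W).
Proof.
case: sgW => _ WD yW; apply/idP/idP=> [xyW|xW]; last exact: WD.
have -> : x = (x + y) + y by char2.
exact: WD.
Qed.

Lemma sub_wspan X : W \subset wspan W X.
Proof.
by apply/subsetP=> w wW; apply/wspanP; exists set0; rewrite ?sub0set // vsum0 addr0.
Qed.

Lemma subgroup_F2_wspan X : subgroup_F2 (wspan W X).
Proof.
split; first by apply: (subsetP (sub_wspan X)); case: sgW.
move=> x y /wspanP[A sA xA] /wspanP[B sB yB]; apply/wspanP.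
exists (symdiff A B); first exact: sub_symdiff.
rewrite vsum_symdiff.
have -> : x + y + (vsum v A + vsum v B) = (x + vsum v A) + (y + vsum v B) by char2.
by case: sgW => _; apply.
Qed.

Lemma wspan_id X e : e \in X -> v e \in wspan W X.
Proof.
move=> eX; apply/wspanP; exists [set e]; rewrite ?sub1set // vsum1 addrr_F2.
by case: sgW.
Qed.

Lemma wspanS X Z : X \subset Z -> wspan W X \subset wspan W Z.
Proof.
move=> sXZ; apply/subsetP=> w /wspanP[J sJ wJ]; apply/wspanP.
by exists J => //; apply: subset_trans sXZ.
Qed.

Lemma wspan_min X U : subgroup_F2 U -> W \subset U -> (forall e, e \in X -> v e \in U) ->
  wspan W X \subset U.
Proof.
move=> sgU sWU sXU; apply/subsetP=> w /wspanP[J sJ wJ].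
have JU : vsum v J \in U.
  by apply: subgroup_F2_vsum => // e eJ; apply: sXU; apply: (subsetP sJ).
have -> : w = (w + vsum v J) + vsum v J by char2.
by case: sgU => _; apply=> //; apply: (subsetP sWU).
Qed.

Variable N : matroid T.
Hypothesis rN : represents N W.

Lemma represents_dependent I : I \subset ground N -> I \notin indep N ->
  exists J, [/\ J \subset I, J != set0 & vsum v J \in W].
Proof.
move=> sI nI; have [/existsP[J /and3P[]]|no] :=
  boolP [exists J : {set T}, [&& J \subset I, J != set0 & vsum v J \in W]].
  by exists J.
case/negP: nI; apply/rN; split=> // J sJ JW; apply/eqP/negPn/negP=> nJ.
by case/negP: no; apply/existsP; exists J; rewrite sJ nJ.
Qed.

Lemma represents_indepU1 B e : B \in indep N -> e \notin B ->
  (e |: B \in indep N) = (e \in ground N) && (v e \notin wspan W B).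
Proof.
move=> iB neB; have [sB fB] := (rN B).1 iB; apply/idP/andP=> [ieB|[eN nW]].
  have [seB feB] := (rN _).1 ieB; split; first by rewrite (subsetP seB) ?setU11.
  apply/wspanP=> -[J sJ eJ]; have /setP/(_ e) : e |: J = set0.
    apply: feB; first exact: setUS.
    by rewrite vsumU1 //; apply: contra neB; apply: (subsetP sJ).
  by rewrite setU11 inE.
apply/negPn/negP=> niB.
have [|J [sJ nJ JW]] := represents_dependent _ niB; first by rewrite subUset sub1set eN.
have [eJ|neJ] := boolP (e \in J).
  case/wspanP: nW; exists (J :\ e); last by rewrite -vsumD1.
  by rewrite subDset.
case/eqP: nJ; apply: fB => //; apply/subsetP=> f fJ.
have := subsetP sJ _ fJ; rewrite !inE; case: eqP => // fe.
by rewrite -fe fJ in neJ.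
Qed.

Lemma basis_of_wspan X B e : basis_of N X B -> e \in X -> e \in ground N ->
  v e \in wspan W B.
Proof.
move=> /basis_ofP[iB sBX maxB] eX eN.
have [eB|neB] := boolP (e \in B); first exact: wspan_id.
apply/negPn/negP=> nW; case/negP: neB; apply: maxB => //.
have neB : e \notin B by apply: contra nW; apply: wspan_id.
by rewrite represents_indepU1 // eN.
Qed.

(** A basis [B] of [X] satisfies W + <B> = W + <X>. Hence a relation modulo W + <X> becomes one
    modulo [W] after adding a subset of [B], and conversely. *)
Lemma represents_contract X : X \subset ground N -> represents (contract N X) (wspan W X).
Proof.
move=> sX I; rewrite inE; apply: (iff_trans (iff_sym (rwP andP))).
split=> [[sI /existsP[B' /andP[bB' iIB']]]|[sI fI]].
  split=> // J sJ JX; have [sIB' fIB'] := (rN _).1 iIB'.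
  have sgB := subgroup_F2_wspan B'; have [_ sBX' _] := basis_ofP _ _ _ bB'.
  have sXB : wspan W X \subset wspan W B'.
    apply: wspan_min; [by [] | exact: sub_wspan |] => e eX.
    by apply: basis_of_wspan bB' eX (subsetP sX _ eX).
  have /wspanP[A sA JA] := subsetP sXB _ JX.
  have dJA : [disjoint J & A].
    have := subset_trans sJ sI; rewrite subsetD => /andP[_].
    by apply: disjointWr; apply: subset_trans sBX'.
  have /eqP : J :|: A = set0.
    apply: fIB'; first by apply: setUSS.
    suff -> : J :|: A = symdiff J A by rewrite vsum_symdiff.
    apply/setP=> x; rewrite in_symdiff inE.
    by have := disjointFr dJA (x := x); case: (x \in J) => [->|].
  by rewrite setU_eq0 => /andP[/eqP].
have [B bB] := basis_of_exists N X; have [iB sBX _] := basis_ofP _ _ _ bB.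
have [sB fB] := (rN B).1 iB.
split=> //; apply/existsP; exists B; rewrite bB; apply/rN; split.
  by rewrite subUset (subset_trans sI (subsetDl _ _)).
move=> Z sZ ZW; have ZB0 : Z :\: B = set0.
  apply: fI; first by rewrite subDset setUC.
  apply/wspanP; exists (Z :&: B); first exact: subset_trans (subsetIr _ _) sBX.
  rewrite (_ : vsum v (Z :\: B) + _ = vsum v Z) //.
  by rewrite [RHS](vsumD v (subsetIl Z B)) addrC setDIr setDv set0U.
by apply: fB => //; rewrite -setD_eq0 ZB0.
Qed.

Lemma rank_basis X B : basis_of N X B -> rank N X = #|B|.
Proof.
move=> bB; have [iB sBX _] := basis_ofP _ _ _ bB; apply/eqP; rewrite eqn_leq.
apply/andP; split.
  by apply/bigmax_leqP=> I /andP[iI sI]; apply: basis_of_card_le bB iI sI.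
by apply: (@leq_bigmax_cond _ _ (fun I : {set T} => #|I|)); rewrite iB.
Qed.

Lemma basis_ofU1 X B e : basis_of N X B -> e \in ground N -> v e \in wspan W B ->
  basis_of N (e |: X) B.
Proof.
move=> /basis_ofP[iB sBX maxB] eN eB; apply/basis_ofP; split=> //.
  by rewrite (subset_trans sBX) ?subsetUr.
move=> f; rewrite in_setU1 => /predU1P[->|]; last exact: maxB.
move=> ieB; apply/negPn/negP=> neB; move: ieB.
by rewrite represents_indepU1 // eB andbF.
Qed.

Lemma flat_closed F e : flat N F -> e \in ground N -> v e \in wspan W F -> e \in F.
Proof.
move=> /eqP fF eN eF; rewrite -fF inE eN /=; apply/eqP.
have sF : F \subset ground N by apply/subsetP=> f; rewrite -fF inE => /andP[].
have [B bB] := basis_of_exists N F.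
rewrite (rank_basis bB); apply: rank_basis; apply: basis_ofU1 => //.
apply: (subsetP (wspan_min _ _ _)) eF; [exact: subgroup_F2_wspan | exact: sub_wspan |].
by move=> f fF'; apply: basis_of_wspan bB fF' (subsetP sF _ fF').
Qed.

(** For a basis [B] of this set, W + <B> stays inside [U], so an element outside [U] extends [B] and
    raises the rank. *)
Lemma flat_subgroup U : subgroup_F2 U -> W \subset U -> flat N [set e in ground N | v e \in U].
Proof.
move=> sgU sWU; set F := [set e in _ | _]; apply/eqP/setP=> e; rewrite inE [in RHS]inE.
case: (boolP (e \in ground N)) => //= eN; apply/eqP/idP=> [rk|eU]; last first.
  by congr (rank N _); apply/setUidPr; rewrite sub1set inE eN.
apply/negPn/negP=> nU; have [B bB] := basis_of_exists N F.
have [iB sBF _] := basis_ofP _ _ _ bB.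
have neB : e \notin B.
  by apply/negP=> /(subsetP sBF); rewrite inE (negPf nU) andbF.
have sBU : wspan W B \subset U.
  by apply: wspan_min => // f /(subsetP sBF); rewrite inE => /andP[].
have : (#|e |: B| <= rank N (e |: F))%N.
  apply: (@leq_bigmax_cond _ _ (fun I : {set T} => #|I|)).
  rewrite represents_indepU1 // eN setUS // andbT.
  by apply: contra nU; apply: (subsetP sBU).
by rewrite rk (rank_basis bB) cardsU1 neB ltnn.
Qed.

Lemma represents_circuit (C : {set T}) :
  reflect [/\ C \subset ground N, vsum v C \in W, C != set0 &
              forall Z : {set T}, Z \subset C -> Z != set0 -> vsum v Z \in W -> Z = C]
          (circuit N C).
Proof.
have dep (Z : {set T}) : Z \subset ground N -> Z != set0 -> vsum v Z \in W -> dependent N Z.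
  move=> sZ nZ ZW; rewrite /dependent sZ; apply/negP=> /rN[_ fZ].
  by case/eqP: nZ; apply: fZ.
apply: (iffP minsetP) => [[/andP[sC nC] minC]|[sC CW nC minC]].
  have minZ (Z : {set T}) : Z \subset C -> Z != set0 -> vsum v Z \in W -> Z = C.
    by move=> sZ nZ ZW; apply: minC => //; apply: dep => //; apply: subset_trans sC.
  have [J [sJ nJ JW]] := represents_dependent sC nC.
  by split=> //; rewrite -(minZ J).
split; first exact: dep.
move=> Z /andP[sZ nZ] sZC; have [J [sJ nJ JW]] := represents_dependent sZ nZ.
apply/eqP; rewrite eqEsubset sZC -{1}(minC J) //; exact: subset_trans sZC.
Qed.

Lemma represents_loop e : loop N e = (e \in ground N) && (v e \in W).
Proof.
apply/represents_circuit/andP=> [[]|[eN eW]].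
  by rewrite sub1set vsum1.
split; rewrite ?sub1set ?vsum1 //; first by apply/set0Pn; exists e; rewrite inE.
by move=> Z; rewrite subset1 => /orP[/eqP|->].
Qed.

Lemma represents_parallel e f : parallel N e f =
  [&& e != f, e \in ground N, f \in ground N, v e \notin W, v f \notin W & v e + v f \in W].
Proof.
rewrite /parallel; have [->//|nef] := eqVneq e f.
apply/represents_circuit/idP=> [[]|/= /and5P[eN fN neW nfW efW]].
  rewrite subUset !sub1set vsum2 // => /andP[-> ->] -> _ minC; rewrite andbT /=.
  have min1 g : g \in [set e; f] -> v g \notin W.
    move=> gef; apply/negP=> gW; have /(congr1 (fun A : {set T} => #|A|)) : [set g] = [set e; f].
      apply: minC; rewrite ?sub1set ?vsum1 //; apply/set0Pn; by exists g; rewrite inE.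
    by rewrite cards1 cards2 nef.
  by rewrite !min1 ?set21 ?set22.
split; rewrite ?subUset ?sub1set ?eN ?vsum2 //.
  by apply/set0Pn; exists e; rewrite set21.
move=> Z sZ nZ ZW; apply/eqP; rewrite eqEsubset sZ subUset !sub1set /=.
apply/andP; split; apply/negPn/negP=> nz.
  case/negP: nfW; rewrite -vsum1 -(_ : Z = [set f]) //; apply/eqP.
  have : Z \subset [set f].
    apply/subsetP=> z zZ; have := subsetP sZ z zZ; rewrite !inE.
    by case: eqP => // ze; rewrite -ze zZ in nz.
  by rewrite subset1 (negPf nZ) orbF.
case/negP: neW; rewrite -vsum1 -(_ : Z = [set e]) //; apply/eqP.
have : Z \subset [set e].
  apply/subsetP=> z zZ; have := subsetP sZ z zZ; rewrite !inE orbC.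
  by case: eqP => // zf; rewrite -zf zZ in nz.
by rewrite subset1 (negPf nZ) orbF.
Qed.


End Subgroup.
End Representation.

(** * Cycle matroids as induced minors *)

Section SymdiffLaw.
Variable T : finType.
Implicit Types A B C : {set T}.

Lemma symdiffA : associative (@symdiff T).
Proof. by move=> A B C; apply/setP=> x; rewrite !in_symdiff addbA. Qed.

Lemma symdiffC : commutative (@symdiff T).
Proof. by move=> A B; apply/setP=> x; rewrite !in_symdiff addbC. Qed.

Lemma symdiff0s : left_id set0 (@symdiff T).
Proof. by move=> A; apply/setP=> x; rewrite in_symdiff inE. Qed.

Lemma symdiff_eq0 A B : (symdiff A B == set0) = (A == B).
Proof.
apply/eqP/eqP=> [/setP AB|->]; last by apply/setP=> x; rewrite in_symdiff addbb inE.
by apply/setP=> x; have := AB x; rewrite in_symdiff inE; do 2 case: (x \in _).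
Qed.

Lemma odd_card_symdiff A B : odd #|symdiff A B| = odd #|A| (+) odd #|B|.
Proof.
have -> : #|symdiff A B| = (#|A :\: B| + #|B :\: A|)%N.
  rewrite cardsU (_ : _ :&: _ = set0) ?cards0 ?subn0 //.
  by apply/setP=> x; rewrite !inE; case: (x \in A); case: (x \in B).
rewrite -(cardsID B A) -(cardsID A B) setIC !oddD.
by case: (odd _); case: (odd _); case: (odd _).
Qed.

End SymdiffLaw.

HB.instance Definition _ (T : finType) :=
  Monoid.isComLaw.Build {set T} set0 (@symdiff T)
    (@symdiffA T) (@symdiffC T) (@symdiff0s T).

Section CycleMatroidRelations.
Variable V : finType.
Implicit Types (F J : {set {set V}}) (A B : {set V}) (x y : V).

(** For a set of edges this is the set of vertices of odd degree, the boundary modulo 2. *)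
Definition boundary J : {set V} := \big[@symdiff V/set0]_(A in J) A.

Lemma boundaryU1 A J : A \notin J -> boundary (A |: J) = symdiff A (boundary J).
Proof. exact: big_setU1. Qed.

Lemma boundary0 : boundary set0 = set0. Proof. exact: big_set0. Qed.

Lemma boundary1 A : boundary [set A] = A. Proof. exact: big_set1. Qed.

Lemma odd_boundary J : (forall A, A \in J -> ~~ odd #|A|) -> ~~ odd #|boundary J|.
Proof.
move=> evJ; apply: (big_ind (fun B : {set V} => ~~ odd #|B|)) => //; first by rewrite cards0.
by move=> A B /negPf oA /negPf oB; rewrite odd_card_symdiff oA oB.
Qed.

Lemma incidence_boundary J : \sum_(A in J) incidence A = incidence (boundary J).
Proof.
rewrite /boundary (big_morph (@incidence V) (op1 := +%R) (id1 := 0)) //.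
  move=> A B; apply/ffunP=> z; rewrite !ffunE in_symdiff.
  by do 2 case: (z \in _); apply/val_inj.
by apply/ffunP=> z; rewrite !ffunE inE.
Qed.

Lemma incidence_eq0 B : incidence B = 0 -> B = set0.
Proof.
move=> B0; apply/setP=> z; rewrite inE; apply/negP=> zB.
by move: B0 => /ffunP/(_ z); rewrite !ffunE zB => /eqP; rewrite oner_eq0.
Qed.

(** Every edge of the path starts at a vertex other than [x] and [y], so none of them joins [x] to
    [y]. *)
Lemma path_avoid F x y a q : path (adj F) a (rcons q x) ->
  all (fun z => (z != x) && (z != y)) (a :: q) ->
  path (adj (F :\ [set x; y])) a (rcons q x).
Proof.
have adjD a' b : (a' != x) && (a' != y) -> adj F a' b -> adj (F :\ [set x; y]) a' b.
  move=> /andP[nx ny] abF; rewrite /adj /= inE [_ \in F]abF andbT inE.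
  apply/eqP=> /setP/(_ a'); rewrite !inE eqxx (negPf nx) (negPf ny) //.
elim: q a => [|b q IHq] a /=; first by rewrite !andbT => ab na; apply: adjD.
by move=> /andP[ab bq] /andP[na nq]; rewrite adjD //= IHq.
Qed.

(** In a cycle of length at least three, the other edges join the ends of the first edge without
    using it, and [connect_incidence] turns this connection into a linear relation. *)
Lemma free_acyclic F : (forall A, A \in F -> #|A| = 2) ->
  free [seq incidence A | A <- enum F] -> acyclic F.
Proof.
move=> F2 freeF; apply/acyclicP=> -[|x [|y [|z q]]] // /andP[].
rewrite /= => /andP[xyF /andP[yzF zq]]; rewrite !inE !negb_or.
move=> /and4P[/and3P[nxy nxz nxq] /andP[nyz nyq] _ _].
have cxy : connect (adj (F :\ [set x; y])) y x.
  apply/connectP; exists (rcons (z :: q) x); last by rewrite last_rcons.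
  rewrite /= /adj /= inE [_ \in F]yzF andbT inE.
  apply/andP; split.
    apply/eqP=> /setP/(_ z); rewrite !inE eqxx orbT eq_sym (negPf nxz).
    by rewrite eq_sym (negPf nyz).
  apply: path_avoid zq _; rewrite /= eq_sym nxz eq_sym nyz /=.
  apply/allP=> t tq; apply/andP; split; [move: nxq | move: nyq];
  by apply: contraNneq => <-.
have F2' A : A \in F :\ [set x; y] -> #|A| = 2 by rewrite inE => /andP[_ /F2].
have := connect_incidence F2' cxy.
rewrite addrC -incidence2 // => /span_subset_sum[J sJ eJ].
have nJ : [set x; y] \notin J by apply/negP=> /(subsetP sJ); rewrite !inE eqxx.
have /free_subset_sum/(_ ([set x; y] |: J)) := freeF.
rewrite subUset sub1set [_ \in F]xyF (subset_trans sJ (subsetDl _ _)) => /(_ isT).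
rewrite big_setU1 //= -eJ => H; suff /setP/(_ [set x; y]) : [set x; y] |: J = set0.
  by rewrite setU11 inE.
by apply: H; apply/ffunP=> t; rewrite !ffunE; case: (_ \in _); apply/val_inj.
Qed.

Variable G : sgraph V.

(** Forests are now described by subset sums, in the same form as [represents], so graphs and
    vectors can be compared relation by relation. *)
Lemma cycle_matroid_indep F :
  reflect (F \subset edges G /\ forall J, J \subset F -> boundary J = set0 -> J = set0)
          (F \in indep (cycle_matroid G)).
Proof.
rewrite inE; apply: (iffP andP) => [[sF aF]|[sF fF]].
  have F2 A : A \in F -> #|A| = 2 by move/(subsetP sF)/card_edge.
  split=> // J sJ J0; have /free_subset_sum := acyclic_free F2 aF.
  apply=> //; rewrite incidence_boundary J0.
  by apply/ffunP=> z; rewrite !ffunE inE.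
split=> //; apply: free_acyclic; first by move=> A /(subsetP sF)/card_edge.
by apply/free_subset_sum=> J sJ; rewrite incidence_boundary => /incidence_eq0; apply: fF.
Qed.

Lemma cycle_matroid_indep_le2 F :
  F \subset edges G -> (#|F| <= 2)%N -> F \in indep (cycle_matroid G).
Proof.
move=> sF F2; apply/cycle_matroid_indep; split=> // J sJ J0.
apply/eqP/negPn/negP=> nJ; have J2 := leq_trans (subset_leq_card sJ) F2.
have edgeN0 A : A \in J -> A != set0.
  by move=> AJ; rewrite -card_gt0 (@card_edge _ G) // (subsetP sF) // (subsetP sJ).
have [A AJ] := set0Pn _ nJ; move: J0; rewrite -(setD1K AJ) boundaryU1 ?setD11 //.
have [->|[B BJ]] := set_0Vmem (J :\ A).
  by rewrite boundary0 symdiffC symdiff0s => A0; have := edgeN0 A AJ; rewrite A0 eqxx.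
have -> : J :\ A = [set B].
  apply/eqP; rewrite eq_sym eqEcard sub1set BJ cards1 -ltnS.
  by move: J2; rewrite (cardsD1 A) AJ.
rewrite boundary1 => /eqP; rewrite symdiff_eq0 => /eqP AB.
by move: BJ; rewrite AB !inE eqxx.
Qed.

End CycleMatroidRelations.

Section CycleMinor.
Variables (m n : nat) (T : finType) (v : T -> 'rV['F_2]_m) (M : matroid T).
Variables (G : sgraph 'I_n) (X : {set T}) (t : 'I_n -> 'rV['F_2]_m).
Implicit Types (A B : {set 'I_n}) (J I : {set T}).

Hypotheses (rM : represents v M [set 0]) (sX : X \subset ground M).
(** [t] puts a vector at each vertex. An affine dependence over GF(2) is an even vertex set with
    zero sum, so this is affine independence modulo <X>. By [edgesG], the even sums present in M/X
    are then exactly the edges. *)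
Hypothesis t_indep : forall B, ~~ odd #|B| -> vsum t B \in lspan v X -> B = set0.
Hypothesis edgesG : forall B, B != set0 -> ~~ odd #|B| ->
  (B \in edges G) = [exists e in ground M, v e + vsum t B \in lspan v X].

Let W := lspan v X.
Let sgW : subgroup_F2 W := subgroup_F2_lspan v X.
Let U := [set y : 'rV['F_2]_m | [exists B : {set 'I_n}, ~~ odd #|B| && (y + vsum t B \in W)]].
Let F := [set e in ground M | v e \in U].

Let sgU : subgroup_F2 U.
Proof.
split; first by rewrite inE; apply/existsP; exists set0; rewrite cards0 vsum0 addr0 lspan0.
move=> x y; rewrite !inE => /existsP[A /andP[eA xA]] /existsP[B /andP[eB yB]].
apply/existsP; exists (symdiff A B); rewrite odd_card_symdiff (negPf eA) (negPf eB) /=.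
have -> : x + y + vsum t (symdiff A B) = (x + vsum t A) + (y + vsum t B).
  by rewrite vsum_symdiff; char2.
exact: lspanD.
Qed.

Let sWU : W \subset U.
Proof.
apply/subsetP=> y yW; rewrite inE; apply/existsP; exists set0.
by rewrite cards0 vsum0 addr0.
Qed.

Let N := contract (restrict M F) X.

Let sXF : X \subset ground (restrict M F).
Proof.
apply/subsetP=> e eX; rewrite !inE (subsetP sX) //=.
by have := subsetP sWU _ (lspan_id v eX); rewrite inE.
Qed.

Let rN : represents v N W.
Proof.
rewrite /W -wspan0; apply: represents_contract => //; first exact: subgroup_F2_0.
exact: represents_restrict.
Qed.

Let groundN e : (e \in ground N) = [&& e \notin X, e \in ground M & v e \in U].
Proof. by rewrite [ground N]/= !in_setD !in_setI [e \in F]inE; case: (e \in ground M). Qed.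

Let edge_even B : B \in edges G -> ~~ odd #|B| /\ B != set0.
Proof. by move=> /card_edge B2; rewrite -card_gt0 B2. Qed.

Let rep_ex B : B \in edges G -> exists e, (e \in ground M) && (v e + vsum t B \in W).
Proof.
move=> BG; have [eB nB] := edge_even BG.
by move: BG; rewrite edgesG // => /existsP[e He]; exists e.
Qed.

(** The edge that [e] represents modulo [W] is unique by [t_inj]; the default [set0] is not an
    edge. *)
Let label e : {set 'I_n} := odflt set0 [pick B : {set 'I_n} in edges G | v e + vsum t B \in W].

Let t_inj A B : ~~ odd #|A| -> ~~ odd #|B| -> vsum t A + vsum t B \in W -> A = B.
Proof.
move=> eA eB; rewrite -vsum_symdiff => AB; apply/eqP; rewrite -symdiff_eq0; apply/eqP.
by apply: t_indep AB; rewrite odd_card_symdiff (negPf eA) (negPf eB).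
Qed.

Let labelE e B : B \in edges G -> v e + vsum t B \in W -> label e = B.
Proof.
move=> BG eB; rewrite /label; case: pickP => [A /andP[AG eA]|/(_ B)] /=; last by rewrite BG eB.
have [oA _] := edge_even AG; have [oB _] := edge_even BG; apply: t_inj => //.
have -> : vsum t A + vsum t B = (v e + vsum t A) + (v e + vsum t B) by char2.
exact: lspanD.
Qed.

Let rep_of e0 (B : {set 'I_n}) : T := odflt e0 [pick e in ground M | v e + vsum t B \in W].

(** Restricting to the flat spanned by [X] and the even vertex sums and then contracting [X] leaves,
    up to loops and parallel elements, one element per edge. *)
Lemma cycle_minor : has_induced_minor M (cycle_matroid G).
Proof.
have [S [SP SE]] : exists S : {set T},
    (forall e, e \in S -> e \in ground M /\ exists2 B, B \in edges G & v e + vsum t B \in W) /\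
    (forall B, B \in edges G -> exists2 e, e \in S &
       v e + vsum t B \in W /\ forall f, f \in S -> v f + vsum t B \in W -> f = e).
  (* [rep_of] takes an element of [T] as default, which any edge provides. *)
  have [/eqP G0|nG] := boolP (edges G == set0).
    by exists set0; split=> [e|B]; rewrite ?G0 inE.
  have [B0 B0G] := set0Pn _ nG; have [e0 _] := rep_ex B0G.
  have repP B : B \in edges G ->
      rep_of e0 B \in ground M /\ v (rep_of e0 B) + vsum t B \in W.
    move=> BG; rewrite /rep_of; case: pickP => [e /andP[]|none] //=.
    by have [e He] := rep_ex BG; have := none e; rewrite He.
  exists (rep_of e0 @: edges G); split=> [_ /imsetP[B BG ->]|B BG].
    by have [? ?] := repP B BG; split=> //; exists B.
  have [_ BW] := repP B BG; exists (rep_of e0 B); first exact: imset_f.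
  split=> // _ /imsetP[A AG ->] ABW; have [_ AW] := repP A AG.
  by rewrite -(labelE BG ABW) (labelE AG AW).
have edgeW B : B \in edges G -> vsum t B \notin W.
  move=> BG; have [oB nB] := edge_even BG.
  by apply/negP=> BW; case/eqP: nB; apply: t_indep.
have SW e : e \in S -> v e \notin W.
  move=> /SP[_ [B BG eB]]; apply: contra (edgeW B BG) => eW.
  have -> : vsum t B = v e + (v e + vsum t B) by char2.
  exact: lspanD.
have SN e : e \in S -> e \in ground N.
  move=> eS; have [eM [B BG eB]] := SP e eS; rewrite groundN eM.
  rewrite (contra (@lspan_id _ _ v X e) (SW e eS)) inE; apply/existsP; exists B.
  by rewrite eB andbT; case: (edge_even BG).
have simpS : simplification_set N S.
  split=> [f fS|e]; first by rewrite SN // (represents_loop rN) (negPf (SW f fS)) andbF.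
  move=> eN; rewrite (represents_loop rN) eN /= => neW.
  have := eN; rewrite groundN inE => /and3P[_ eM /existsP[B /andP[oB eB]]].
  have nB : B != set0 by apply: contraNneq neW => B0; rewrite -[v e]addr0 -(vsum0 t) -B0.
  have BG : B \in edges G by rewrite edgesG //; apply/exists_inP; exists e.
  have [f fS [fB fU]] := SE B BG; exists f; split.
    split=> //; have [//|nef] := eqVneq e f.
    rewrite (represents_parallel rN) nef eN SN // neW SW //=.
    have -> : v e + v f = (v e + vsum t B) + (v f + vsum t B) by char2.
    exact: lspanD.
  move=> f' [f'S ef']; apply/esym/fU => //.
  have [/eqP <-//|] := orP ef'; rewrite (represents_parallel rN).
  case/and5P=> _ _ _ _ /andP[_ eff].
  have -> : v f' + vsum t B = (v e + v f') + (v e + vsum t B) by char2.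
  exact: lspanD.
exists (restrict N S).
  apply: induced_minor_contract => //.
  apply: induced_minor_restrict; first exact: induced_minor_refl.
  by apply: (flat_subgroup rM) => //; rewrite sub1set; case: sgU.
have gS : ground (restrict N S) = S.
  by apply/setIidPr/subsetP=> e /SN.
have labelP e : e \in S -> label e \in edges G /\ v e + vsum t (label e) \in W.
  by move=> /SP[_ [B BG eB]]; rewrite (labelE BG eB).
have injS : {in S &, injective label}.
  move=> e f eS fS ef; have [eG eW] := labelP e eS; have [_ fW] := labelP f fS.
  have [g gS' [gW gU]] := SE _ eG; by rewrite (gU e) // (gU f) // ef.
exists label; rewrite gS; split=> //.
  apply/setP=> B; apply/imsetP/idP=> [[e /labelP[? _] ->] //|BG].
  by have [e eS [eB _]] := SE B BG; exists e; rewrite ?(labelE BG eB).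
move=> I sI; have rS := represents_restrict S rN.
(* Modulo [W] the sum of [J] is the sum of [t] over the boundary of its labels. This boundary is an
   even vertex set, so [t_indep] applies to it. *)
have vsum_label J : J \subset S ->
    (vsum v J \in W) = (boundary [set label e | e in J] == set0).
  move=> sJ; set b := boundary _.
  have JW : vsum v J + vsum t b \in W.
    rewrite /b /boundary (big_morph (vsum t) (op1 := +%R) (id1 := 0));
      [ | exact: vsum_symdiff | exact: vsum0].
    rewrite big_imset /=; last by move=> e f eJ fJ; apply: injS; apply: (subsetP sJ).
    rewrite -big_split; apply: (big_ind (fun x => x \in W)).
    - exact: lspan0.
    - by move=> x y; apply: lspanD.
    by move=> e /(subsetP sJ)/labelP[].
  have ob : ~~ odd #|b|.
    apply: odd_boundary => _ /imsetP[e /(subsetP sJ)/labelP[eG _] ->].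
    by case: (edge_even eG).
  apply/idP/eqP=> [JW'|b0]; last by move: JW; rewrite b0 vsum0 addr0.
  apply: t_indep => //; have -> : vsum t b = vsum v J + (vsum v J + vsum t b) by char2.
  exact: lspanD.
apply/idP/idP=> [/cycle_matroid_indep[_ fI]|/rS[_ fI]];
  [apply/rS | apply/cycle_matroid_indep]; split.
- by rewrite gS.
- move=> J sJ; rewrite vsum_label ?(subset_trans sJ) // => /eqP/fI J0.
  by apply/eqP; rewrite -(imset_eq0 label) J0 // imsetS.
- by apply/subsetP=> _ /imsetP[e eI ->]; case: (labelP e (subsetP sI e eI)).
move=> L sL L0; pose J := [set e in I | label e \in L].
have LJ : L = label @: J.
  apply/setP=> A; apply/idP/imsetP=> [AL|[e]]; last by rewrite inE => /andP[_ eL] ->.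
  by have /imsetP[e eI eA] := subsetP sL A AL; exists e; rewrite // inE eI -eA.
have sJ : J \subset I by apply/subsetP=> e; rewrite inE => /andP[].
by rewrite LJ (fI J) ?imset0 // vsum_label ?(subset_trans sJ) // -LJ L0.
Qed.

End CycleMinor.

(** * Forbidden planes and minor invariants *)

Section ForbiddenMinors.
Variables (m : nat) (T : finType) (v : T -> 'rV['F_2]_m) (M : matroid T).
Hypothesis rM : represents v M [set 0].
Implicit Types (X : {set T}) (B : {set 'I_4}) (a b c y : 'rV['F_2]_m).

(* The vertices 1, 2, 0, 3 carry the vectors 0, a, b, c, and the edge ij stands
   for the sum of the vectors at i and j. *)
Lemma four_point_minor (G : sgraph 'I_4) (e03 : bool) X a b c :
  (forall B, (B \in edges G) =
     (#|B| == 2) && (e03 || ~~ ((ord0 \in B) && (ord_max \in B)))) ->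
  X \subset ground M ->
  point v (ground M) X a -> point v (ground M) X b -> point v (ground M) X c ->
  point v (ground M) X (b + a) -> point v (ground M) X (a + c) ->
  b + c \notin lspan v X -> point v (ground M) X (b + c) = e03 ->
  b + (a + c) \notin lspan v X -> ~~ point v (ground M) X (b + (a + c)) ->
  has_induced_minor M (cycle_matroid G).
Proof.
move=> edgesG sX pa pb pc pba pac nbc pbc nbac pbac.
pose t (i : 'I_4) := nth 0 [:: b; 0; a; c] i.
pose o1 : 'I_4 := lift ord0 ord0; pose o2 : 'I_4 := lift ord0 (lift ord0 ord0).
pose o3 : 'I_4 := lift ord0 (lift ord0 (lift ord0 ord0)).
have max3 : ord_max = o3 by apply: val_inj.
(* Sums and cardinals are unfolded into membership of the four vertices, so that the hypotheses of
   [cycle_minor] can be checked on all sixteen vertex sets. *)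
have tE B : vsum t B = (if ord0 \in B then b else 0) +
    ((if o1 \in B then 0 else 0) + ((if o2 \in B then a else 0) +
    ((if o3 \in B then c else 0) + 0))).
  by rewrite /vsum big_mkcond !big_ord_recl big_ord0.
have cardE B : #|B| = ((if ord0 \in B then 1 else 0) +
    ((if o1 \in B then 1 else 0) + ((if o2 \in B then 1 else 0) +
    ((if o3 \in B then 1 else 0) + 0))))%N.
  by rewrite -sum1_card big_mkcond !big_ord_recl big_ord0.
have pN y : point v (ground M) X y -> y \in lspan v X = false.
  by case/andP=> /negPf.
apply: (@cycle_minor _ _ _ v _ _ X t rM sX) => [B|B].
  move=> oB tB; apply/eqP; rewrite -cards_eq0; move: oB tB; rewrite tE cardE.
  case: (ord0 \in B); case: (o1 \in B); case: (o2 \in B); case: (o3 \in B) => //= _;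
  by rewrite !(addr0, add0r) ?(negPf nbc) ?(negPf nbac) ?pN.
have -> : [exists e in ground M, v e + vsum t B \in lspan v X] =
          [exists e in ground M, vsum t B + v e \in lspan v X].
  by apply: eq_existsb => e; rewrite addrC.
have pE y : y \notin lspan v X ->
    [exists e in ground M, y + v e \in lspan v X] = point v (ground M) X y.
  by rewrite /point => ->.
rewrite -card_gt0 edgesG max3 tE cardE.
case: (ord0 \in B); case: (o1 \in B); case: (o2 \in B); case: (o3 \in B) => //= _ _;
by rewrite !(addr0, add0r) pE ?pa ?pb ?pc ?pba ?pac ?pbc ?(negPf pbac)
  ?orbT ?orbF ?nbc ?nbac ?pN.
Qed.

(** Of the seven points of the plane only [b + c] and [a + b + c] are in question. If both are
    missing, the plane is the cycle matroid of K4\e. If only [b + c] is missing, it is that of K4;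
    replacing [c] by [a + c] makes the missing point the sum over all four vertices. *)
Lemma minor_free_plane :
  ~ has_induced_minor M (cycle_matroid K4_minus_edge) ->
  ~ has_induced_minor M (cycle_matroid K4) ->
  forall X a b c, X \subset ground M ->
  point v (ground M) X a -> point v (ground M) X b ->
  point v (ground M) X (a + b) -> point v (ground M) X c ->
  point v (ground M) X (a + c) -> point0 v (ground M) X (b + c).
Proof.
move=> noK4e noK4 X a b c sX pa pb pab pc pac; apply/negPn/negP.
rewrite /point0 negb_or => /andP[nbc pbc].
have nbac : b + (a + c) \notin lspan v X.
  apply: contra pbc => bacX; have -> : b + c = a + (b + (a + c)) by char2.
  by rewrite point_shift.
rewrite [a + b]addrC in pab; have [pbac|pbac] := boolP (point v (ground M) X (b + (a + c))).
  have aac : a + (a + c) = c by char2.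
  by apply: noK4; apply: (@four_point_minor K4 true X a b (a + c));
    rewrite ?aac // => B; rewrite inE andbT.
apply: noK4e; apply: (@four_point_minor K4_minus_edge false X a b c); rewrite // ?(negPf pbc) //.
move=> B; rewrite !inE andbC; case: eqP => //= B2.
have -> : (ord0 \in B) && (ord_max \in B) = ([set ord0; ord_max] \subset B).
  by rewrite subUset !sub1set.
by rewrite [B == _]eq_sym eqEcard B2 cards2 andbT.
Qed.

End ForbiddenMinors.

Section MinorInvariants.
Variables (m : nat) (T : finType) (v : T -> 'rV['F_2]_m).
Implicit Types (M N : matroid T) (E F J X S : {set T}) (W : {set 'rV['F_2]_m}).

Definition line_closed E W := forall e f, e \in E -> f \in E ->
  v e \notin W -> v f \notin W -> v e + v f \notin W ->
  exists2 g, g \in E & v e + v f + v g \in W.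

(** Elements may coincide: with [e = f] the first clause excludes loops, and for distinct elements
    it excludes triangles. *)
Definition affine_closed E W := forall e f g, e \in E -> f \in E -> g \in E ->
  v e + v f + v g \notin W /\ exists2 h, h \in E & v e + v f + v g + v h \in W.

Definition unique_relation E W := forall J J', J \subset E -> J' \subset E ->
  J != set0 -> J' != set0 -> vsum v J \in W -> vsum v J' \in W -> J = J'.

(** The vectors stay the same along a sequence of minors and only the ground set and [W] change, so
    [P] is a property of this pair. *)
Lemma induced_minor_invariant (P : {set T} -> {set 'rV['F_2]_m} -> Prop) M W :
  (forall N W F, subgroup_F2 W -> represents v N W -> flat N F ->
     P (ground N) W -> P (ground (restrict N F)) W) ->
  (forall N W X S, subgroup_F2 W -> represents v N W -> X \subset ground N ->
     simplification_set (contract N X) S -> P (ground N) W ->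
     P (ground (restrict (contract N X) S)) (wspan v W X)) ->
  subgroup_F2 W -> represents v M W -> P (ground M) W ->
  forall N, induced_minor M N ->
  exists W', [/\ subgroup_F2 W', represents v N W' & P (ground N) W'].
Proof.
move=> Prestr Pcontr sgW rM PM N.
elim=> [|{}N F _ [W' [sgW' rN PN]] fF|{}N X S _ [W' [sgW' rN PN]] sX sS].
- by exists W.
- exists W'; split=> //; [exact: represents_restrict | exact: Prestr].
exists (wspan v W' X); split; first exact: subgroup_F2_wspan.
  by apply: represents_restrict; apply: represents_contract.
exact: Pcontr.
Qed.

Lemma simplification_rep N W S h : subgroup_F2 W -> represents v N W -> simplification_set N S ->
  h \in ground N -> v h \notin W ->
  exists2 f, f \in ground N :&: S & v h + v f \in W.
Proof.
move=> [W0 _] rN [Sground Srep] hN nh; have [|f [[fS hf] _]] := Srep h hN.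
  by rewrite (represents_loop rN) hN.
have fN : f \in ground N by case/andP: (Sground f fS).
exists f; first by rewrite inE fN.
case/orP: hf => [/eqP->|]; first by rewrite addrr_F2.
by rewrite (represents_parallel rN) => /and5P[_ _ _ _ /andP[]].
Qed.

Lemma unique_relation_restrict N W F :
  unique_relation (ground N) W -> unique_relation (ground (restrict N F)) W.
Proof.
move=> uN J J' sJ sJ'; apply: uN.
  exact: subset_trans sJ (subsetIl _ _).
exact: subset_trans sJ' (subsetIl _ _).
Qed.

(** Adding a suitable subset of [X] lifts a relation modulo W + <X> to one modulo [W]. The lift
    agrees with the original outside [X], so equal lifts come from equal relations. *)
Lemma unique_relation_contract N W X S : X \subset ground N ->
  unique_relation (ground N) W ->
  unique_relation (ground (restrict (contract N X) S)) (wspan v W X).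
Proof.
move=> sX uN J J' sJ sJ' nJ nJ' /wspanP[A sA JA] /wspanP[A' sA' JA'].
have disj (K B : {set T}) : K \subset (ground N :\: X) :&: S -> B \subset X ->
    K :&: B = set0 /\ symdiff K B \subset ground N.
  move=> sK sB; have sK1 := subset_trans sK (subsetIl _ _).
  split; last by rewrite sub_symdiff ?(subset_trans sB) // (subset_trans sK1) ?subsetDl.
  apply/setP=> x; rewrite !inE; apply/negP=> /andP[xK xB].
  by have := subsetP sK1 x xK; rewrite inE (subsetP sB).
have [dJ sJA] := disj _ _ sJ sA; have [dJ' sJA'] := disj _ _ sJ' sA'.
have sdN (K B : {set T}) : K != set0 -> K :&: B = set0 -> symdiff K B != set0.
  move=> nK KB; rewrite symdiff_eq0; apply: contraNneq nK => eKB.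
  by rewrite -KB -eKB setIid.
have /setP eJ : symdiff J A = symdiff J' A'.
  by apply: uN; rewrite ?sdN // vsum_symdiff.
apply/setP=> x; have := eJ x; rewrite !in_symdiff.
have out (K B : {set T}) : K \subset (ground N :\: X) :&: S -> B \subset X ->
    x \in X -> x \in K = false.
  move=> sK sB xX; apply/negP=> /(subsetP sK); by rewrite !inE xX.
have [xX|nxX] := boolP (x \in X); first by rewrite (out J A) // (out J' A').
have outX (B : {set T}) : B \subset X -> x \in B = false.
  by move=> sB; apply/negP=> /(subsetP sB); rewrite (negPf nxX).
by rewrite (outX A) // (outX A') // !addbF.
Qed.

(** Simplification may discard the third point of a line; the element of [S] equal or parallel to it
    takes its place. *)
Lemma line_closed_contract N W X S : subgroup_F2 W -> represents v N W ->
  X \subset ground N -> simplification_set (contract N X) S ->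
  (forall e f, e \in ground N :\: X -> f \in ground N :\: X ->
     v e + v f \notin wspan v W X ->
     exists2 g, g \in ground N & v e + v f + v g \in wspan v W X) ->
  line_closed (ground (restrict (contract N X) S)) (wspan v W X).
Proof.
move=> sgW rN sX sS line e f; rewrite !(in_setI _ (ground _)).
move=> /andP[eN _] /andP[fN _] _ _ nef.
have sgWX := subgroup_F2_wspan v sgW X; have rNX := represents_contract sgW rN sX.
have [g gN efg] := line e f eN fN nef.
have ng : v g \notin wspan v W X.
  by apply: contra nef => gW; rewrite -(subgroup_F2_addr sgWX _ gW).
have gNX : g \in ground (contract N X).
  by rewrite inE gN andbT; apply: contra ng; apply: wspan_id.
have [h hS gh] := simplification_rep sgWX rNX sS gNX ng; exists h => //.
have -> : v e + v f + v h = (v e + v f + v g) + (v g + v h) by char2.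
by case: sgWX => _; apply.
Qed.

(** The element that completes the relation is, modulo [W], a sum of elements of [F], so it belongs
    to the flat. *)
Lemma geometry_restrict N W F : subgroup_F2 W -> represents v N W -> flat N F ->
  line_closed (ground N) W \/ affine_closed (ground N) W ->
  line_closed (ground (restrict N F)) W \/ affine_closed (ground (restrict N F)) W.
Proof.
move=> sgW rN fF.
have mem1 e : e \in ground (restrict N F) -> e \in ground N /\ v e \in wspan v W F.
  by rewrite inE => /andP[-> eF]; split=> //; apply: wspan_id.
have [_ Fadd] := subgroup_F2_wspan v sgW F; have sWF := subsetP (sub_wspan v W F).
case=> [lN|aN]; [left=> e f|right=> e f g].
  move=> /mem1[eN eF] /mem1[fN fF'] ne nf nef.
  have [g gN efg] := lN e f eN fN ne nf nef; exists g => //.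
  rewrite inE gN; apply: (flat_closed sgW rN fF gN).
  have -> : v g = (v e + v f) + (v e + v f + v g) by char2.
  by apply: (Fadd); [apply: Fadd | apply: sWF].
move=> /mem1[eN eF] /mem1[fN fF'] /mem1[gN gF].
have [nefg [h hN efgh]] := aN e f g eN fN gN; split=> //; exists h => //.
rewrite inE hN; apply: (flat_closed sgW rN fF hN).
have -> : v h = (v e + v f + v g) + (v e + v f + v g + v h) by char2.
by apply: (Fadd); [do 2 apply: (Fadd) => // | apply: sWF].
Qed.

(** In the affine case, the relation completing an element [x] of [X] with [e] and [f] becomes a
    line through [e] and [f] once [x] is contracted. If [X] is empty, only the simplification takes
    place and the affine property persists. *)
Lemma geometry_contract N W X S : subgroup_F2 W -> represents v N W ->
  X \subset ground N -> simplification_set (contract N X) S ->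
  line_closed (ground N) W \/ affine_closed (ground N) W ->
  line_closed (ground (restrict (contract N X) S)) (wspan v W X) \/
  affine_closed (ground (restrict (contract N X) S)) (wspan v W X).
Proof.
move=> sgW rN sX sS; have sub := subsetP (sub_wspan v W X).
case=> [lN|aN].
  left; apply: line_closed_contract => // e f; rewrite !in_setD => /andP[eX eN] /andP[fX fN] nef.
  have [eW|neW] := boolP (v e \in wspan v W X).
    exists f => //; have -> : v e + v f + v f = v e by char2.
    by [].
  have [fW|nfW] := boolP (v f \in wspan v W X).
    exists e => //; have -> : v e + v f + v e = v f by char2.
    by [].
  have [||| g gN efg] := lN e f eN fN; try by [apply: contra neW; apply: sub |
    apply: contra nfW; apply: sub | apply: contra nef; apply: sub].
  by exists g => //; apply: sub.
have [X0|[x xX]] := set_0Vmem X; last first.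
  left; apply: line_closed_contract => // e f; rewrite !in_setD => /andP[eX eN] /andP[fX fN] nef.
  have [_ [g gN xefg]] := aN x e f (subsetP sX x xX) eN fN; exists g => //.
  have -> : v e + v f + v g = (v x + v e + v f + v g) + v x by char2.
  by have [_] := subgroup_F2_wspan v sgW X; apply; [apply: sub | apply: wspan_id].
right=> e f g; have sgWX := subgroup_F2_wspan v sgW X.
have WX w : (w \in wspan v W X) = (w \in W).
  apply/idP/idP=> [/wspanP[J]|]; last exact: sub.
  by rewrite X0 subset0 => /eqP->; rewrite vsum0 addr0.
have rNX := represents_contract sgW rN sX.
rewrite !(in_setI _ (ground _)) ![ground (contract _ _)]/= X0 setD0.
move=> /andP[eN _] /andP[fN _] /andP[gN _].
rewrite -X0 !WX; have [nefg [h hN efgh]] := aN e f g eN fN gN; split=> //.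
have hNX : h \in ground (contract N X) by rewrite inE X0 inE hN.
have nh : v h \notin wspan v W X.
  rewrite WX; apply: contra nefg => hW; by rewrite -(subgroup_F2_addr sgW _ hW).
have [k kS hk] := simplification_rep sgWX rNX sS hNX nh; exists k => //.
rewrite WX in hk; rewrite WX.
have -> : v e + v f + v g + v k = (v e + v f + v g + v h) + (v h + v k) by char2.
by case: sgW => _; apply.
Qed.

End MinorInvariants.

(** * Matroids containing the diamond *)

Section Diamond.
Variable G : sgraph 'I_4.
(** Both excluded graphs satisfy this condition, so they are treated together; the edge 03 may or
    may not be present. *)
Hypothesis diamond : forall B : {set 'I_4},
  #|B| = 2 -> B != [set ord0; ord_max] -> B \in edges G.

Let o1 : 'I_4 := @Ordinal 4 1 isT.
Let o2 : 'I_4 := @Ordinal 4 2 isT.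
Let o3 : 'I_4 := @Ordinal 4 3 isT.

Let edgeP (i j k : 'I_4) : i != j -> k \in [set i; j] ->
  k \notin [set ord0; ord_max] -> [set i; j] \in edges G.
Proof.
move=> nij kij k03; apply: diamond; first by rewrite cards2 nij.
by apply: contraNneq k03 => <-.
Qed.

Let e01 : [set ord0; o1] \in edges G. Proof. by apply: (edgeP (k := o1)); rewrite ?inE. Qed.
Let e02 : [set ord0; o2] \in edges G. Proof. by apply: (edgeP (k := o2)); rewrite ?inE. Qed.
Let e12 : [set o1; o2] \in edges G. Proof. by apply: (edgeP (k := o1)); rewrite ?inE. Qed.
Let e13 : [set o1; o3] \in edges G. Proof. by apply: (edgeP (k := o1)); rewrite ?inE. Qed.
Let e23 : [set o2; o3] \in edges G. Proof. by apply: (edgeP (k := o2)); rewrite ?inE. Qed.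

Let neqP (A B : {set 'I_4}) i : (i \in A) != (i \in B) -> A != B.
Proof. by apply: contraNneq => ->. Qed.

(** The edges 01 and 23 form a perfect matching, so their symmetric difference is the whole vertex
    set, which is not an edge. Hence they lie in no common triangle. *)
Lemma opposite_edges_indep x : x \in edges G ->
  x |: [set [set ord0; o1]; [set o2; o3]] \in indep (cycle_matroid G).
Proof.
move=> xG; set F := x |: _.
have n01 : [set ord0; o1] != [set o2; o3] by apply: (neqP (i := ord0)); rewrite !inE.
have sF : F \subset edges G by rewrite !subUset !sub1set xG e01.
apply/cycle_matroid_indep; split=> // J sJ J0.
have [J2|J3] := leqP #|J| 2.
  have /cycle_matroid_indep[_] := cycle_matroid_indep_le2 (subset_trans sJ sF) J2.
  by apply.
have cF : #|F| = ((x \notin [set [set ord0; o1]; [set o2; o3]]) + 2)%N.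
  by rewrite cardsU1 cards2 n01.
have nx : x \notin [set [set ord0; o1]; [set o2; o3]].
  by have := leq_trans J3 (subset_leq_card sJ); rewrite cF; case: (_ \notin _).
have JF : J = F by apply/eqP; rewrite eqEcard sJ cF nx.
move: J0; rewrite JF boundaryU1 // boundaryU1 ?inE // boundary1 => /eqP.
rewrite symdiff_eq0 => /eqP x0123; have := card_edge xG.
rewrite x0123 (_ : symdiff _ _ = setT) ?cardsT ?card_ord //.
apply/setP=> i; rewrite in_symdiff !inE.
by case: i => [[|[|[|[|//]]]] ?].
Qed.

Lemma triangle_dep (A B C : {set 'I_4}) : A != B -> A != C -> B != C ->
  symdiff A (symdiff B C) = set0 -> A |: [set B; C] \notin indep (cycle_matroid G).
Proof.
move=> nAB nAC nBC ABC; apply/cycle_matroid_indep=> -[_ /(_ _ (subxx _))].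
rewrite !boundaryU1 ?boundary1 ?inE ?negb_or ?nAB // => /(_ ABC) /setP/(_ A).
by rewrite setU11 inE.
Qed.

Section NotIsomorphic.
Variables (m : nat) (T : finType) (v : T -> 'rV['F_2]_m) (N : matroid T).
Variable W : {set 'rV['F_2]_m}.
Hypotheses (rN : represents v N W) (iso : isomorphic N (cycle_matroid G)).

Implicit Types I J : {set T}.

Let edge_elt A : A \in edges G -> forall f : T -> {set 'I_4},
  f @: ground N = ground (cycle_matroid G) -> exists2 e, e \in ground N & f e = A.
Proof. by move=> AG f fN; move: AG; rewrite -[edges G]fN => /imsetP[e eN ->]; exists e. Qed.

(** [line_closed] fails at the edges 01 and 23, which no third edge completes to a line, and
    [affine_closed] fails at the triangle 01, 12, 02. *)
Lemma diamond_not_geometry :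
  ~ (line_closed v (ground N) W \/ affine_closed v (ground N) W).
Proof.
have [f [injf fN fI]] := iso.
have relP I J : I \subset ground N -> f @: I \in indep (cycle_matroid G) ->
    J \subset I -> vsum v J \in W -> J = set0.
  by move=> sI; rewrite fI // => /rN[_]; apply.
have fG e : e \in ground N -> f e \in edges G.
  by move=> eN; have : f e \in f @: ground N by [apply: imset_f]; rewrite fN.
case=> [lN|aN].
  have [e eN fe] := edge_elt e01 fN; have [g gN fg] := edge_elt e23 fN.
  have indepP h : h \in ground N -> f @: (h |: [set e; g]) \in indep (cycle_matroid G).
    by move=> hN; rewrite !imsetU1 imset_set1 fe fg; apply: opposite_edges_indep; apply: fG.
  have sub h : h \in ground N -> h |: [set e; g] \subset ground N.
    by move=> hN; rewrite !subUset !sub1set hN eN.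
  have neg : e != g.
    apply/eqP=> eg; have /eqP : [set ord0; o1] = [set o2; o3] by rewrite -fe -fg eg.
    by apply/negP; apply: (neqP (i := ord0)); rewrite !inE.
  have ne : v e \notin W.
    apply/negP; rewrite -vsum1 => /(relP _ _ (sub e eN) (indepP e eN)) e0.
    by have /setP/(_ e) := e0 (subsetUl _ _); rewrite !inE eqxx.
  have ng : v g \notin W.
    apply/negP; rewrite -vsum1 => /(relP _ _ (sub g gN) (indepP g gN)) e0.
    by have /setP/(_ g) := e0 (subsetUl _ _); rewrite !inE eqxx.
  have neg' : v e + v g \notin W.
    apply/negP; rewrite -vsum2 // => /(relP _ _ (sub e eN) (indepP e eN)) e0.
    by have /setP/(_ e) := e0 (subsetUr _ _); rewrite !inE eqxx.
  have [h hN egh] := lN e g eN gN ne ng neg'.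
  have [hs|nhs] := boolP (h \in [set e; g]).
    move: egh; case/set2P: hs => ->.
      by rewrite addrC addrA addrr_F2 add0r (negPf ng).
    by rewrite -addrA addrr_F2 addr0 (negPf ne).
  have /(relP _ _ (sub h hN) (indepP h hN) (subxx _))/setP/(_ h) : vsum v (h |: [set e; g]) \in W.
    by rewrite vsumU1 // vsum2 // addrC.
  by rewrite setU11 inE.
have [e eN fe] := edge_elt e01 fN; have [g gN fg] := edge_elt e12 fN.
have [h hN fh] := edge_elt e02 fN.
have sI : e |: [set g; h] \subset ground N by rewrite !subUset !sub1set eN gN.
have : f @: (e |: [set g; h]) \notin indep (cycle_matroid G).
  rewrite !imsetU1 imset_set1 fe fg fh; apply: triangle_dep.
  - by apply: (neqP (i := ord0)); rewrite !inE.
  - by apply: (neqP (i := o1)); rewrite !inE.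
  - by apply: (neqP (i := ord0)); rewrite !inE.
  apply/setP=> i; rewrite !in_symdiff !inE.
  by case: i => [[|[|[|[|//]]]] ?].
rewrite fI // => /(represents_dependent rN sI)[J [sJ nJ JW]].
(* At most two edges are always independent, so a relation within the triangle involves all three of
   its elements. *)
have [J2|J3] := leqP #|J| 2.
  case/eqP: nJ; apply: (relP J J) => //; first exact: subset_trans sI.
  apply: cycle_matroid_indep_le2; last exact: leq_trans (leq_imset_card _ _) J2.
  by apply/subsetP=> _ /imsetP[x xJ ->]; apply: fG; apply: (subsetP sI); apply: (subsetP sJ).
have cI : (#|e |: [set g; h]| = (e \notin [set g; h]) + (g != h).+1)%N.
  by rewrite cardsU1 cards2.
have JI : J = e |: [set g; h].
  apply/eqP; rewrite eqEcard sJ (leq_trans _ J3) // cI.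
  by case: (_ \notin _); case: (_ != _).
move: J3 JW; rewrite JI cI; case: (boolP (e \notin _)) => [neI|_]; last by case: (_ != _).
case: (boolP (g != h)) => // ngh _; rewrite vsumU1 // vsum2 // addrA.
by have [/negPf->] := aN e g h eN gN hN.
Qed.

(** The triangles 12, 01, 02 and 12, 13, 23 share only the edge 12. A relation common to both would
    lie in this single edge, which is independent. *)
Lemma diamond_not_unique : ~ unique_relation v (ground N) W.
Proof.
have [f [injf fN fI]] := iso; move=> uN.
have triangle A B C e g h : e \in ground N -> g \in ground N -> h \in ground N ->
    f e = A -> f g = B -> f h = C ->
    A != B -> A != C -> B != C -> symdiff A (symdiff B C) = set0 ->
    exists J, [/\ J \subset e |: [set g; h], J \subset ground N, J != set0 & vsum v J \in W].
  move=> eN gN hN fe fg fh nAB nAC nBC ABC.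
  have sI : e |: [set g; h] \subset ground N by rewrite !subUset !sub1set eN gN.
  have : f @: (e |: [set g; h]) \notin indep (cycle_matroid G).
    by rewrite !imsetU1 imset_set1 fe fg fh; apply: triangle_dep.
  rewrite fI // => /(represents_dependent rN sI)[J [sJ nJ JW]].
  by exists J; split=> //; apply: subset_trans sI.
have [e eN fe] := edge_elt e12 fN.
have [a aN fa] := edge_elt e01 fN; have [b bN fb] := edge_elt e02 fN.
have [c cN fc] := edge_elt e13 fN; have [d dN fd] := edge_elt e23 fN.
have [| | | |J [sJ sJN nJ JW]] := triangle _ _ _ _ _ _ eN aN bN fe fa fb.
- by apply: (neqP (i := ord0)); rewrite !inE.
- by apply: (neqP (i := ord0)); rewrite !inE.
- by apply: (neqP (i := o1)); rewrite !inE.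
- apply/setP=> i; rewrite !in_symdiff !inE.
  by case: i => [[|[|[|[|//]]]] ?].
have [| | | |J' [sJ' sJN' nJ' JW']] := triangle _ _ _ _ _ _ eN cN dN fe fc fd.
- by apply: (neqP (i := o2)); rewrite !inE.
- by apply: (neqP (i := o1)); rewrite !inE.
- by apply: (neqP (i := o1)); rewrite !inE.
- apply/setP=> i; rewrite !in_symdiff !inE.
  by case: i => [[|[|[|[|//]]]] ?].
have JJ := uN J J' sJN sJN' nJ nJ' JW JW'; rewrite -JJ in sJ'.
have sJe : J \subset [set e].
  apply/subsetP=> x xJ; rewrite inE; apply/negPn/negP=> nxe.
  have := subsetP sJ x xJ; rewrite !inE (negPf nxe) /= => xab.
  have := subsetP sJ' x xJ; rewrite !inE (negPf nxe) /= => xcd.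
  have : (ord0 \in f x) by case/orP: xab => /eqP->; rewrite ?fa ?fb !inE.
  by case/orP: xcd => /eqP->; rewrite ?fc ?fd !inE.
have iJ : J \in indep N.
  rewrite -fI //; apply: cycle_matroid_indep_le2.
    apply/subsetP=> _ /imsetP[x xJ ->]; rewrite -[edges G]fN; apply: imset_f.
    exact: (subsetP sJN).
  apply: leq_trans (leq_imset_card _ _) _; apply: leq_trans (subset_leq_card sJe) _.
  by rewrite cards1.
by have [_ /(_ J (subxx _) JW) J0] := (rN J).1 iJ; rewrite J0 eqxx in nJ.
Qed.

End NotIsomorphic.
End Diamond.

Lemma K4_diamond (B : {set 'I_4}) :
  #|B| = 2 -> B != [set ord0; ord_max] -> B \in edges K4.
Proof. by move=> B2 _; rewrite inE B2. Qed.

Lemma K4_minus_edge_diamond (B : {set 'I_4}) :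
  #|B| = 2 -> B != [set ord0; ord_max] -> B \in edges K4_minus_edge.
Proof. by move=> B2 nB; rewrite !inE nB B2. Qed.

(** * From matroids to spanning vector configurations and back *)

Section Coordinates.
Variables (T : finType) (M : matroid T).
Implicit Types (J Z D : {set T}).

Lemma simple_relations (m : nat) (v : T -> 'rV['F_2]_m) :
  represents v M [set 0] -> simple_matroid M ->
  forall Z, Z \subset ground M -> vsum v Z = 0 -> Z != set0 -> (2 < #|Z|)%N.
Proof.
move=> rM [noloop nopar] Z sZ Z0 nZ; rewrite ltnNge; apply/negP.
have nl e : e \in ground M -> v e != 0.
  by move=> eM; have := noloop e; rewrite (represents_loop rM) eM inE.
rewrite leq_eqVlt => /orP[/cards2P[e [f [nef Zef]]]|]; last first.
  rewrite ltnS leq_eqVlt ltnS leqn0 cards_eq0 (negPf nZ) orbF => /cards1P[e Ze].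
  by move: Z0 sZ; rewrite Ze vsum1 sub1set => /eqP e0 /nl/negP.
move: Z0 sZ; rewrite Zef vsum2 // subUset !sub1set => ef0 /andP[eM fM].
by have := nopar e f; rewrite (represents_parallel rM) nef eM fM !inE !nl // ef0 eqxx.
Qed.

Lemma connected_relations (m : nat) (v : T -> 'rV['F_2]_m) :
  represents v M [set 0] -> connected_matroid M ->
  forall e f, e \in ground M -> f \in ground M -> e != f ->
  exists D, [/\ D \subset ground M, e \in D, f \in D, vsum v D = 0 &
    forall Z, Z \subset D -> vsum v Z = 0 -> Z = set0 \/ Z = D].
Proof.
move=> rM conn e f eM fM nef; have [D [cD eD fD]] := conn e f eM fM nef.
have [sD D0 nD minD] := (represents_circuit rM D) cD; exists D; split=> //.
  by move: D0; rewrite inE => /eqP.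
move=> Z sZ Z0; have [->|nZ] := eqVneq Z set0; [by left | right].
by apply: minD; rewrite // inE Z0.
Qed.

(** An isomorphism with [PG r] requires vectors that span the whole space. Coordinates with respect
    to a basis of the span provide them, and additivity of [L] carries over the relations found for
    [v]. *)
Lemma coordinates (m : nat) (v : T -> 'rV['F_2]_m) : represents v M [set 0] ->
  exists (r : nat) (L : 'rV['F_2]_m -> 'rV['F_2]_r),
    [/\ {morph L : x y / x + y}, represents (L \o v) M [set 0] &
        forall y, exists2 J : {set T}, J \subset ground M & y = vsum (L \o v) J].
Proof.
move=> rM; pose U := <<[seq v e | e <- enum (ground M)]>>%VS.
pose X := vbasis U; have bX := vbasisP U; rewrite -/X in bX.
pose L (y : 'rV['F_2]_m) : 'rV['F_2]_(\dim U) := \row_i coord X i y.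
pose u := L \o v.
have sumL J : vsum u J = L (vsum v J).
  by apply/rowP=> i; rewrite mxE linear_sum summxE; apply: eq_bigr => e _; rewrite mxE.
have inU J : J \subset ground M -> vsum v J \in U.
  by move=> sJ; apply/span_subset_sum; exists J.
have E0 J : J \subset ground M -> (vsum u J == 0) = (vsum v J == 0).
  move=> sJ; rewrite sumL; apply/eqP/eqP=> [/rowP J0|->].
    rewrite (coord_vbasis (inU J sJ)) big1 // => i _.
    by have := J0 i; rewrite !mxE => ->; rewrite scale0r.
  by apply/rowP=> i; rewrite !mxE linear0.
exists (\dim U), L; split; first by move=> x y; apply/rowP=> i; rewrite !mxE linearD.
  move=> I; split=> [/rM[sI fI]|[sI fI]].
    split=> // J sJ; rewrite inE E0 ?(subset_trans sJ) // => /eqP J0.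
    by apply: fI; rewrite // inE J0.
  apply/rM; split=> // J sJ; rewrite inE -E0 ?(subset_trans sJ) // => /eqP J0.
  by apply: fI; rewrite // inE J0.
move=> y; pose w := \sum_i y 0 i *: X`_i.
have wU : w \in U.
  by apply: memv_suml => i _; apply: memvZ; apply: vbasis_mem; rewrite mem_nth ?size_tuple.
have [J sJ eJ] := span_subset_sum _ _ _ wU; exists J => //.
rewrite sumL /vsum -eJ; apply/rowP=> i; rewrite mxE coord_sum_free //.
exact: basis_free bX.
Qed.

End Coordinates.

Lemma PG_represents (r : nat) : represents id (PG r) [set 0].
Proof. exact: represents_vector. Qed.

Section IsomorphicRepresentation.
Variables (T : finType) (M : matroid T) (r : nat) (N : matroid 'rV['F_2]_r).
Hypothesis rN : represents id N [set 0].
Implicit Types (I J : {set T}).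

Let vsum_imset (u : T -> 'rV['F_2]_r) J : {in ground M &, injective u} ->
  J \subset ground M -> vsum id (u @: J) = vsum u J.
Proof.
move=> inj sJ; apply: big_imset => e f eJ fJ.
by apply: inj; apply: (subsetP sJ).
Qed.

Let indep_imset (u : T -> 'rV['F_2]_r) I : {in ground M &, injective u} ->
  u @: ground M = ground N -> I \subset ground M ->
  (u @: I \in indep N) <-> (forall J, J \subset I -> vsum u J \in [set 0] -> J = set0).
Proof.
move=> inj uM sI; split=> [/rN[_ fI] J sJ|fI].
  rewrite -vsum_imset ?(subset_trans sJ) // => /(fI _ (imsetS _ sJ))/eqP.
  by rewrite imset_eq0 => /eqP.
apply/rN; split=> [|Z sZ Z0]; first by rewrite -uM imsetS.
pose J := [set e in I | u e \in Z].
have ZJ : Z = u @: J.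
  apply/setP=> y; apply/idP/imsetP=> [yZ|[e]]; last by rewrite inE => /andP[_ eZ] ->.
  by have /imsetP[e eI ye] := subsetP sZ y yZ; exists e; rewrite // inE eI -ye.
have sJ : J \subset I by apply/subsetP=> e; rewrite inE => /andP[].
by rewrite ZJ (fI J) ?imset0 // -vsum_imset -?ZJ // (subset_trans sJ).
Qed.

Lemma isomorphic_represents : isomorphic M N ->
  exists2 u : T -> 'rV['F_2]_r, represents u M [set 0] & u @: ground M = ground N.
Proof.
case=> u [inj uM uI]; exists u => // I.
split=> [iI|[sI fI]]; first have sI := indep_ground iI.
  by split=> //; apply/(indep_imset inj uM sI); rewrite uI.
by rewrite -uI //; apply/(indep_imset inj uM sI).
Qed.

Lemma represents_isomorphic (u : T -> 'rV['F_2]_r) : represents u M [set 0] ->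
  {in ground M &, injective u} -> u @: ground M = ground N -> isomorphic M N.
Proof.
move=> rM inj uM; exists u; split=> // I sI.
apply/idP/idP=> [/(indep_imset inj uM sI) fI|/rM[_ fI]]; first by apply/rM.
exact/(indep_imset inj uM sI).
Qed.

End IsomorphicRepresentation.

(** * Projective and affine geometries *)

Section Geometries.
Variables (T : finType) (M : matroid T) (r : nat) (u : T -> 'rV['F_2]_r).
Implicit Types (J : {set T}) (x y z : 'rV['F_2]_r).

Lemma in_PG y : (y \in ground (PG r)) = (y != 0).
Proof. by rewrite inE. Qed.

(** Zero is adjoined because it is not a point of [PG r]. A basis [B] of [H] together with [x] has
    full rank, so [y] is the sum of a subset of [x |: B]. As [y] is outside, this subset contains
    [x], and [x + y] lies in the span of [B]. *)
Lemma hyperplane_complement (H : {set 'rV['F_2]_r}) : hyperplane (PG r) H ->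
  subgroup_F2 (0 |: H) /\
  forall x y, x \notin 0 |: H -> y \notin 0 |: H -> x + y \in 0 |: H.
Proof.
move=> /andP[fH /eqP rkH]; have rPG := @PG_represents r; set D := 0 |: H.
have [_ addH] := subgroup_F2_wspan id (@subgroup_F2_0 r) H.
have sgD : subgroup_F2 D.
  split=> [|x y]; first exact: setU11.
  move=> /setU1P[->|xH]; first by rewrite add0r.
  move=> /setU1P[->|yH]; first by rewrite addr0 setU1r.
  have [->|nxy] := eqVneq (x + y) 0; first exact: setU11.
  apply: setU1r; apply: (flat_closed (@subgroup_F2_0 r) rPG fH); first by rewrite in_PG.
  by apply: addH; apply: (@wspan_id _ _ id _ (@subgroup_F2_0 r)).
split=> // x y nx ny; have [D0 addD] := sgD.
have [B bB] := basis_of_exists (PG r) H; have [iB sBH _] := basis_ofP _ _ _ bB.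
have sBD : wspan id [set 0] B \subset D.
  apply: wspan_min => //; first by rewrite sub1set.
  by move=> b bB'; apply: setU1r; apply: (subsetP sBH).
have nz z : z \notin D -> z \in ground (PG r) /\ z \notin B.
  move=> nzD; rewrite in_PG; split; apply: contra nzD; first by move/eqP->.
  by move=> zB; apply: setU1r; apply: (subsetP sBH).
have [xP xB] := nz x nx; have [yP yB] := nz y ny.
have ixB : x |: B \in indep (PG r).
  rewrite (represents_indepU1 rPG) // xP /=.
  by apply: contra nx; apply: (subsetP sBD).
have [->|nyx] := eqVneq y x; first by rewrite addrr_F2.
have yxB : y \notin x |: B by rewrite !inE negb_or nyx.
have [|nyW] := boolP (y \in wspan id [set 0] (x |: B)); last first.
  have iyxB : y |: (x |: B) \in indep (PG r).
    by rewrite (represents_indepU1 rPG) // yP.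
  have : (#|y |: (x |: B)| <= matroid_rank (PG r))%N.
    apply: (@leq_bigmax_cond _ _ (fun I : {set _} => #|I|)).
    by rewrite iyxB; apply: (@indep_ground _ (PG r)).
  by rewrite -rkH (rank_basis bB) !cardsU1 yxB xB !add1n ltnn.
case/wspanP=> J sJ; rewrite inE addr_eq0_F2 => /eqP yJ.
have inD (K : {set 'rV['F_2]_r}) : K \subset B -> vsum id K \in D.
  move=> sK; apply: subgroup_F2_vsum => // e eK.
  by apply: setU1r; apply: (subsetP sBH); apply: (subsetP sK).
have [xJ|nxJ] := boolP (x \in J).
  rewrite yJ (vsumD1 _ xJ) addrA addrr_F2 add0r; apply: inD.
  by rewrite subDset.
case/negP: ny; rewrite yJ; apply: inD; apply/subsetP=> z zJ.
by have := subsetP sJ z zJ; rewrite !inE; case: eqP => // zx; rewrite -zx zJ in nxJ.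
Qed.

Lemma PG_line_closed : u @: ground M = ground (PG r) -> line_closed u (ground M) [set 0].
Proof.
move=> uM e f eM fM _ _; rewrite inE -in_PG -uM => /imsetP[g gM efg].
by exists g; rewrite // efg addrr_F2 inE.
Qed.

(** By index two, the sum of three vectors off the hyperplane is again off it, hence nonzero and an
    element of the geometry. *)
Lemma AG_affine_closed (H : {set 'rV['F_2]_r}) : hyperplane (PG r) H ->
  u @: ground M = ground (restrict (PG r) (~: H)) -> affine_closed u (ground M) [set 0].
Proof.
move=> /hyperplane_complement[[D0 addD] index2] uM e f g eM fM gM.
have memM y : (y \in u @: ground M) = (y \notin 0 |: H).
  by rewrite uM inE in_PG !inE negb_or.
have nD h : h \in ground M -> u h \notin 0 |: H by move=> hM; rewrite -memM imset_f.
have nefg : u e + u f + u g \notin 0 |: H.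
  apply: contra (nD g gM) => efgD.
  have -> : u g = (u e + u f) + (u e + u f + u g) by char2.
  by apply: addD => //; apply: index2; apply: nD.
split; first by rewrite inE; apply: contraNneq nefg => ->.
move: nefg; rewrite -memM => /imsetP[h hM efgh].
by exists h; rewrite // efgh addrr_F2 inE.
Qed.

Hypotheses (rM : represents u M [set 0])
  (simpleM : forall Z : {set T}, Z \subset ground M -> vsum u Z = 0 -> Z != set0 -> (2 < #|Z|)%N)
  (spanning : forall y, exists2 J : {set T}, J \subset ground M & y = vsum u J).

Let u_inj : {in ground M &, injective u}.
Proof.
move=> e f eM fM ef; apply/eqP/negPn/negP=> nef.
have n0 : [set e; f] != set0 by apply/set0Pn; exists e; rewrite set21.
have := simpleM (Z := [set e; f]); rewrite vsum2 // ef addrr_F2 cards2 nef.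
by rewrite subUset !sub1set eM fM => /(_ isT erefl n0).
Qed.

Let u_neq0 e : e \in ground M -> u e != 0.
Proof.
move=> eM; apply/eqP=> e0.
have n0 : [set e] != set0 by apply/set0Pn; exists e; rewrite set11.
have := simpleM (Z := [set e]).
by rewrite vsum1 e0 cards1 sub1set eM => /(_ isT erefl n0).
Qed.

(** Closed lines make the image together with zero a subgroup, and since it spans, it is the whole
    space. *)
Lemma isomorphic_PG :
  (forall e f, e \in ground M -> f \in ground M -> e != f ->
     exists2 g, g \in ground M & u e + u f + u g = 0) ->
  isomorphic M (PG r).
Proof.
move=> lines; apply: (represents_isomorphic (@PG_represents r) rM u_inj).
have sg : subgroup_F2 (0 |: u @: ground M).
  split=> [|x y]; first exact: setU11.
  move=> /setU1P[->|/imsetP[e eM ->]]; first by rewrite add0r.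
  move=> /setU1P[->|/imsetP[f fM ->]]; first by rewrite addr0 setU1r ?imset_f.
  have [->|nef] := eqVneq e f; first by rewrite addrr_F2 setU11.
  have [g gM /eqP] := lines e f eM fM nef; rewrite addr_eq0_F2 => /eqP->.
  by rewrite setU1r ?imset_f.
apply/setP=> y; rewrite in_PG; apply/imsetP/idP=> [[e eM ->]|ny]; first exact: u_neq0.
have [J sJ yJ] := spanning y.
have /setU1P[y0|/imsetP[e eM ye]] : y \in 0 |: u @: ground M.
- rewrite yJ; apply: subgroup_F2_vsum => // e eJ; apply: setU1r; apply: imset_f.
  exact: (subsetP sJ).
- by rewrite y0 eqxx in ny.
by exists e.
Qed.

(** The image [E] is closed under sums of three and spans. So its complement [D] equals [x0 + E] and
    is a subgroup of index two, whose nonzero vectors form the hyperplane. *)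
Lemma isomorphic_AG e0 : e0 \in ground M ->
  (forall e f g, e \in ground M -> f \in ground M -> g \in ground M ->
     exists2 h, h \in ground M & u e + u f + u g + u h = 0) ->
  exists2 H, hyperplane (PG r) H & isomorphic M (restrict (PG r) (~: H)).
Proof.
move=> e0M planes; pose E := u @: ground M; pose x0 := u e0; pose D := ~: E.
have E0 : 0 \notin E by apply/imsetP=> -[e /u_neq0/eqP e0' /esym].
have E3 x y z : x \in E -> y \in E -> z \in E -> x + y + z \in E.
  move=> /imsetP[e eM ->] /imsetP[f fM ->] /imsetP[g gM ->].
  have [h hM /eqP] := planes e f g eM fM gM; rewrite addr_eq0_F2 => /eqP->.
  exact: imset_f.
have x0E : x0 \in E by apply: imset_f.
(* A sum of an odd number of elements of [E] lies in [E], and a sum of an even number lies in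
   [x0 + E]. *)
have cover y : (y \in E) || (x0 + y \in E).
  have [J sJ ->] := spanning y.
  apply: (big_ind (fun y => (y \in E) || (x0 + y \in E))).
  - by rewrite addr0 x0E orbT.
  - move=> y1 y2 /orP[] Ey1 /orP[] Ey2.
    + by rewrite addrA E3 ?orbT.
    + have -> : y1 + y2 = y1 + (x0 + y2) + x0 by char2.
      by rewrite E3.
    + have -> : y1 + y2 = (x0 + y1) + y2 + x0 by char2.
      by rewrite E3.
    have -> : x0 + (y1 + y2) = (x0 + y1) + (x0 + y2) + x0 by char2.
    by rewrite E3 ?orbT.
  by move=> e eJ; rewrite imset_f // (subsetP sJ).
have inD y : (y \in D) = (x0 + y \in E).
  rewrite inE; apply/idP/idP=> [nyE|xyE]; first by have := cover y; rewrite (negPf nyE).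
  apply: contra E0 => yE; have -> : 0 = x0 + y + (x0 + y) by char2.
  by rewrite addrA E3.
have sgD : subgroup_F2 D.
  split=> [|y z]; first by rewrite inE.
  rewrite !inD => yD zD; have -> : x0 + (y + z) = x0 + (x0 + y) + (x0 + z) by char2.
  exact: E3.
have rPG := @PG_represents r; pose H := [set y in ground (PG r) | id y \in D].
have sD0 : [set 0] \subset D by rewrite sub1set; case: sgD.
have fH : flat (PG r) H by apply: flat_subgroup.
have nx0D : x0 \notin D by rewrite inE x0E.
have inH y : y \in D -> y != 0 -> y \in H by move=> yD ny; rewrite 2!inE ny.
exists H.
  rewrite /hyperplane fH; have [B bB] := basis_of_exists (PG r) H.
  have [iB sBH _] := basis_ofP _ _ _ bB.
  have sBD : B \subset D by apply/subsetP=> b /(subsetP sBH); rewrite inE => /andP[].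
  have nx0B : x0 \notin B by apply: contra nx0D; apply: (subsetP sBD).
  have x0P : x0 \in ground (PG r) by rewrite in_PG u_neq0.
  have ix0B : x0 |: B \in indep (PG r).
    rewrite (represents_indepU1 rPG) // x0P /=; apply: contra nx0D; apply: subsetP.
    by apply: wspan_min => // b; apply: (subsetP sBD).
  have sB : wspan id [set 0] B \subset wspan id [set 0] (x0 |: B).
    by apply: wspanS; apply: subsetUr.
  have HB y : y \in D -> y \in wspan id [set 0] (x0 |: B).
    move=> yD; apply: (subsetP sB); have [->|ny] := eqVneq y 0.
      by have [] := subgroup_F2_wspan id (@subgroup_F2_0 r) B.
    apply: (basis_of_wspan (@subgroup_F2_0 r) rPG bB); first exact: inH.
    by rewrite in_PG.
  (* A vector outside [D] differs from [x0] by a vector of [D], so adding [x0] to a basis of [H]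
     spans everything. *)
  have bx0B : basis_of (PG r) (ground (PG r)) (x0 |: B).
    apply/basis_ofP; split=> //; first exact: indep_ground ix0B.
    move=> y yP iy; apply/negPn/negP=> nyB; move: iy.
    rewrite (represents_indepU1 rPG) // yP /= => /negP; apply.
    have [yD|nyD] := boolP (y \in D); first exact: HB.
    have -> : id y = (x0 + y) + x0 by rewrite /=; char2.
    have [_ addB] := subgroup_F2_wspan id (@subgroup_F2_0 r) (x0 |: B); apply: addB.
      apply: HB; rewrite inD; have -> : x0 + (x0 + y) = y by char2.
      by move: nyD; rewrite inE negbK.
    by apply: (@wspan_id _ _ id _ (@subgroup_F2_0 r)); rewrite setU11.
  by rewrite /matroid_rank (rank_basis bB) (rank_basis bx0B) cardsU1 nx0B /=; apply/eqP.
have rAG := represents_restrict (~: H) rPG.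
apply: (represents_isomorphic rAG rM u_inj).
apply/setP=> y; rewrite inE in_PG !inE negb_and negbK -/E.
have [->|ny] /= := eqVneq y 0; first exact: negbTE.
by rewrite negbK.
Qed.

End Geometries.

(** * The two directions of the characterization *)

Section BothDirections.
Variables (T : finType) (M : matroid T).
Hypotheses (simpleM : simple_matroid M) (binM : binary M).

Lemma minor_free_classes : connected_matroid M ->
  ~ has_induced_minor M (cycle_matroid K4_minus_edge) ->
  ~ has_induced_minor M (cycle_matroid K4) ->
  projective_geometry M \/
  (affine_geometry M /\ (3 <= matroid_rank M)%N) \/
  (circuit M (ground M) /\ (3 <= #|ground M|)%N).
Proof.
move=> connM noK4e noK4; have [m [v /represents_vector rM]] := binM.
have plane := minor_free_plane rM noK4e noK4.
have [r [L [LD rL span]]] := coordinates rM.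
have L0 : L 0 = 0 by apply: (@addrI _ (L 0)); rewrite -LD !addr0.
have simpleL := simple_relations rL simpleM.
case: (classification plane (simple_relations rM simpleM) (connected_relations rM connM))
  => [lines|[planes [I [sI I3 fI]]]|[C0 minC C3]].
- left; exists r; apply: (isomorphic_PG rL simpleL span) => e f eM fM nef.
  by have [g gM efg] := lines e f eM fM nef; exists g => //=; rewrite -!LD efg.
- right; left; split; last first.
    suff : (#|I| <= matroid_rank M)%N by rewrite I3.
    apply: (@leq_bigmax_cond _ _ (fun J : {set T} => #|J|)); rewrite sI andbT.
    by apply/rM; split=> // J sJ; rewrite inE => /eqP; apply: fI.
  have /set0Pn[e0 e0I] : I != set0 by rewrite -card_gt0 I3.
  have [|H hypH isoH] := isomorphic_AG rL simpleL span (subsetP sI e0 e0I); last first.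
    by exists r, H.
  move=> e f g eM fM gM; have [h hM efgh] := planes e f g eM fM gM.
  by exists h => //=; rewrite -!LD efgh.
right; right; split=> //; apply/(represents_circuit rM); split=> //.
- by rewrite C0 inE.
- by rewrite -card_gt0 (leq_trans _ C3).
by move=> Z sZ nZ; rewrite inE => /eqP/(minC Z sZ)[Z0|//]; rewrite Z0 eqxx in nZ.
Qed.

Lemma classes_minor_free (G : sgraph 'I_4) :
  (forall B : {set 'I_4}, #|B| = 2 -> B != [set ord0; ord_max] -> B \in edges G) ->
  [\/ projective_geometry M, affine_geometry M | circuit M (ground M)] ->
  ~ has_induced_minor M (cycle_matroid G).
Proof.
move=> diamG classes [N minorN isoN].
have geometry r (u : T -> 'rV['F_2]_r) : represents u M [set 0] ->
    line_closed u (ground M) [set 0] \/ affine_closed u (ground M) [set 0] -> False.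
  move=> ru geoM; have [W [sgW rN geoN]] := induced_minor_invariant
    (P := fun E W => line_closed u E W \/ affine_closed u E W)
    (@geometry_restrict _ _ u) (@geometry_contract _ _ u) (@subgroup_F2_0 r) ru geoM minorN.
  exact: (diamond_not_geometry diamG rN isoN geoN).
case: classes => [[r isoM]|[r [H [hypH isoM]]]|circM].
- have [u ru uM] := isomorphic_represents (@PG_represents r) isoM.
  by apply: (geometry r u ru); left; apply: PG_line_closed.
- have [u ru uM] := isomorphic_represents (represents_restrict _ (@PG_represents r)) isoM.
  by apply: (geometry r u ru); right; apply: AG_affine_closed uM.
have [m [v /represents_vector rM]] := binM.
have [_ C0 nC minC] := (represents_circuit rM _) circM.
have uniqM : unique_relation v (ground M) [set 0].
  by move=> J J' sJ sJ' nJ nJ' J0 J0'; rewrite (minC J) // (minC J').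
have [||W [sgW rN uniqN]] := induced_minor_invariant
  (P := unique_relation v) _ _ (@subgroup_F2_0 m) rM uniqM minorN.
- by move=> N' W F _ _ _; apply: unique_relation_restrict.
- by move=> N' W X S _ _ sX _; apply: unique_relation_contract.
exact: (diamond_not_unique diamG rN isoN uniqN).
Qed.

End BothDirections.

Local Close Scope ring_scope.

Theorem theorem1p2 (T : finType) (M : matroid T)
    (hconn : connected_matroid M) (hsimple : simple_matroid M)
    (hbin : binary M) :
  (~ has_induced_minor M (cycle_matroid K4_minus_edge) /\
   ~ has_induced_minor M (cycle_matroid K4))
  <->
  (projective_geometry M \/
   (affine_geometry M /\ 3 <= matroid_rank M) \/
   (circuit M (ground M) /\ 3 <= #|ground M|)).
Proof.
split=> [[noK4e noK4]|classes]; first exact: minor_free_classes.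
have {}classes : [\/ projective_geometry M, affine_geometry M | circuit M (ground M)].
  by case: classes => [|[[]|[]]]; [constructor 1 | constructor 2 | constructor 3].
split; apply: classes_minor_free => //; [exact: K4_minus_edge_diamond | exact: K4_diamond].
Qed.
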